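(* Fix $\theta\in\mathbb{R}\setminus\mathbb{Q}$ and let $(q_k)_{k=0}^\infty$ be the sequence of the denominators of the convergents of $\theta$. Then the following are equivalent: (A) For every Khinchin sequence $\psi:\mathbb{N}\to(0,\infty)$, the set $W(\theta,\psi)$ has full measure. (B) For some $\epsilon>0$, $$\limsup_{k\to\infty}\frac{1}{\log(q_k)}\,\Sigma\left(\left(\log\left(\frac{q_{i+1}}{q_i}\right)\right)_{i=0}^{k-1} : \frac{\epsilon\log(q_k)}{\log\log(q_k)}\right)<1.$$
   Context: $\mathbb{N}=\{1,2,3,\ldots\}$. For $x\in\mathbb{R}$, $\|x\|$ denotes the distance from $x$ to the nearest integer. For $\theta\in\mathbb{R}$ and $\psi:\mathbb{N}\to(0,\infty)$, $$W(\theta,\psi)=\{s\in\mathbb{R} : \|q\theta-s\|<\psi(q)\text{ for infinitely many } q\in\mathbb{N}\}.$$ ''Full measure'' means that the complement in $\mathbb{R}$ has Lebesgue measure zero. A function $\psi:\mathbb{N}\to(0,\infty)$ is called a Khinchin sequence if $\sum_{q=1}^\infty\psi(q)=\infty$ and the function $q\mapsto q\psi(q)$ is nonincreasing. The denominators of the convergents of the irrational number $\theta$ with (simple) continued fraction expansion $[a_0;a_1,a_2,\ldots]$ are given by $q_0=1$, $q_1=a_1$, $q_{k+1}=a_{k+1}q_k+q_{k-1}$ for $k\geq 1$. For a finite sequence of real numbers $(a_i)_{i=1}^n$ and an integer $m\geq 0$, $\Sigma\big((a_i)_{i=1}^n : m\big)$ denotes the sum of the $m$ largest elements of the sequence (counted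 with multiplicity), with $\Sigma\big((a_i)_{i=1}^n : m\big)=\sum_{i=1}^n a_i$ if $m\geq n$. For real $\alpha\geq 0$, $\Sigma\big((a_i)_{i=1}^n : \alpha\big)=\Sigma\big((a_i)_{i=1}^n : \lfloor\alpha\rfloor\big)$. The same notation is used for sequences indexed by $i=0,\ldots,k-1$. The expressions inside the limsup are defined for all sufficiently large $k$ (those for which $\log\log(q_k)>0$), which is all that matters for the limsup. *)

(* Defs.v *)
From mathcomp Require Import all_boot all_order all_algebra.
From mathcomp Require Import all_classical all_reals all_analysis.

Set Implicit Arguments.
Unset Strict Implicit.
Unset Printing Implicit Defensive.

Import Order.TTheory GRing.Theory Num.Theory.
Import numFieldNormedType.Exports.

Local Open Scope classical_set_scope.
Local Open Scope ring_scope.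

Definition dist_int (R : realType) (x : R) : R :=
  inf [set `|x - m%:~R| | m in [set: int]].

(* Sequences on {1, 2, 3, ...} are functions on nat whose value at 0 is
   never used. *)
Definition W (R : realType) (theta : R) (psi : nat -> R) : set R :=
  [set s | infinite_set
    [set q : nat | (0 < q)%N /\ dist_int (q%:R * theta - s) < psi q]].

Definition full_measure (R : realType) (A : set R) : Prop :=
  (@lebesgue_measure R).-negligible (~` A).

Definition Khinchin (R : realType) (psi : nat -> R) : Prop :=
  [/\ forall q : nat, (0 < q)%N -> 0 < psi q,
      (\sum_(1 <= q <oo) (psi q)%:E = +oo)%E
    & forall p q : nat, (0 < p)%N -> (p <= q)%N ->
        q%:R * psi q <= p%:R * psi p].

Definition gauss_step (R : realType) (x : R) : R :=
  (x - (Num.floor x)%:~R)^-1.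

Definition partial_quotient (R : realType) (theta : R) (k : nat) : int :=
  Num.floor (iter k (@gauss_step R) theta).

Fixpoint denominator (R : realType) (theta : R) (k : nat) : int :=
  match k with
  | 0 => 1
  | k1.+1 =>
      match k1 with
      | 0 => partial_quotient theta 1
      | k2.+1 => partial_quotient theta k * denominator theta k1
                 + denominator theta k2
      end
  end.

(* Num.truncn alpha is the integer part of alpha when 0 <= alpha. *)
Definition sum_largest (R : realType) (s : seq R) (alpha : R) : R :=
  \sum_(x <- take (Num.truncn alpha) (sort >=%R s)) x.

(* Main.v *)
Require Import Defs.
From mathcomp Require Import all_boot all_order all_algebra.
From mathcomp Require Import all_classical all_reals all_analysis.
From mathcomp Require Import measurable_realfun ring lra zify.

Set Implicit Arguments.
Unset Strict Implicit.
Unset Printing Implicit Defensive.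

Import Order.TTheory GRing.Theory Num.Theory.
Import numFieldNormedType.Exports.

Local Open Scope classical_set_scope.
Local Open Scope ring_scope.

(* Let t_k = ln q_k, and let x_n be the fractional part of n theta.

   (A) => (B).  If (B) fails, there are indices k_j such that the gaps
   ln (q_(i+1) / q_i), i < k_j, outside a family of 2^-j T / ln T of them, where
   T = t_(k_j), add up to at most 2^-j T.  Take q psi(q) = 1 / T for
   q_(k_(j-1)) <= q < q_(k_j).  The points s approximated by some n theta with
   q_i <= n < q_(i+1) have measure O(1 / T) min (gap_i, ln T): when the gap is
   large, the n theta with n <= q_(i+1) / T lie in q_i short clusters.  Hence the
   j-th stretch contributes O(2^-j), and W is null by Borel-Cantelli.

   (B) => (A).  Let Psi(q) = min (q psi(q), 1 / (1 + ln q)) and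
   r_n = min (Psi(n) / n, 1 / (4 q_(i+1))) for q_i <= n < q_(i+1).  Under (B), the
   sum of min (gap_i, ln (t_k / 8)) over i < k is at least a fixed multiple of t_k,
   which makes the sum of the r_n over suitable geometric stretches of t comparable
   to the sum of Psi(n) / n; so it diverges.  The balls B(x_n, r_n) with n in one
   block [q_i, q_(i+1)) are disjoint, and the points x_n with n in a window of
   length q_i are 1 / (2 q_i)-separated; the resulting count bounds the sum of the
   measures of the pairwise intersections by a multiple of the square of the sum of
   the r_n, and the second moment method gives a limsup set of positive measure.
   Finally W is invariant under s -> s + 1 and W - theta is contained in W, so that
   Lebesgue's density theorem forces a set W of positive measure to be full. *)

(** * Convergents *)

Section ContinuedFraction.
Variables (R : realType) (theta : R).
Hypothesis htheta : irrational theta.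

Let x k : R := iter k (@gauss_step R) theta.
Let a k : int := partial_quotient theta k.

Lemma irrational_gauss_step (y : R) : irrational y -> irrational (gauss_step y).
Proof.
move=> iy [r _ er]; apply: iy; exists ((Num.floor y)%:~R + r^-1); first by [].
by rewrite rmorphD/= ratr_int fmorphV/= er /gauss_step invrK subrKC.
Qed.

Lemma irrational_neq_int (y : R) (m : int) : irrational y -> y != m%:~R.
Proof.
by move=> iy; apply/eqP => ey; apply: iy; exists m%:~R; rewrite // ratr_int.
Qed.

Lemma gauss_step_gt1 (y : R) : irrational y -> 1 < gauss_step y.
Proof.
move=> iy; have lt1 := floorD1_gt y; have := Num.Theory.floor_le y.
rewrite /gauss_step le_eqVlt eq_sym (negbTE (irrational_neq_int _ iy))/= => fl.
rewrite invf_gt1 ?subr_gt0//; move: lt1; rewrite intrD; lra.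
Qed.

Lemma irrational_complete_quotient k : irrational (x k).
Proof. by elim: k => [//|k IH]; rewrite /x iterS; apply: irrational_gauss_step. Qed.

Lemma complete_quotient_gt1 k : 1 < x k.+1.
Proof. by rewrite /x iterS; apply/gauss_step_gt1/irrational_complete_quotient. Qed.

Lemma complete_quotient_step k : x k - (a k)%:~R = (x k.+1)^-1.
Proof. by rewrite {2}/x iterS /gauss_step invrK. Qed.

Lemma partial_quotient_ge1 k : 1 <= a k.+1.
Proof.
by rewrite /a /partial_quotient Num.Theory.floor_ge_int /= ltW//; apply: complete_quotient_gt1.
Qed.

Fixpoint numerator k : int :=
  match k with
  | 0 => a 0
  | k1.+1 =>
      match k1 with
      | 0 => a 1 * a 0 + 1
      | k2.+1 => a k * numerator k1 + numerator k2
      end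
  end.

Arguments numerator : simpl never.

Lemma numeratorSS k : numerator k.+2 = a k.+2 * numerator k.+1 + numerator k.
Proof. by []. Qed.

Lemma denominatorSS k :
  denominator theta k.+2 = a k.+2 * denominator theta k.+1 + denominator theta k.
Proof. by []. Qed.

Lemma denominator_ge1 k : 1 <= denominator theta k.
Proof.
suff : (1 <= denominator theta k) && (1 <= denominator theta k.+1) by case/andP.
elim: k => [|k /andP[h1 h2]]; first by rewrite lexx /= partial_quotient_ge1.
rewrite h2 denominatorSS; have := partial_quotient_ge1 k.+1; nia.
Qed.

Definition qn k : nat := `|denominator theta k|%N.

Lemma qnE k : (qn k)%:Z = denominator theta k.
Proof. by rewrite /qn gez0_abs// (le_trans _ (denominator_ge1 k)). Qed.

Lemma qnRE k : (qn k)%:R = (denominator theta k)%:~R :> R.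
Proof. by rewrite -qnE. Qed.

Lemma qn_gt0 k : (0 < qn k)%N.
Proof. by have := denominator_ge1 k; rewrite -qnE; lia. Qed.

Lemma qnSS k : (qn k.+1 + qn k <= qn k.+2)%N.
Proof.
have := denominatorSS k; rewrite -!qnE.
have := partial_quotient_ge1 k.+1; have := qn_gt0 k.+1; nia.
Qed.

Lemma qn_leS k : (qn k <= qn k.+1)%N.
Proof.
case: k => [|k]; first by rewrite -lez_nat !qnE denominator_ge1.
by have := qnSS k; lia.
Qed.

Lemma qn_homo : {homo qn : k l / (k <= l)%N}.
Proof. by apply: homo_leq => [//|? ? ?|]; [apply: leq_trans|apply: qn_leS]. Qed.

Lemma qn_double k : (2 * qn k <= qn k.+2)%N.
Proof. by have := qnSS k; have := qn_leS k; lia. Qed.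

Lemma qn_ge k : (k <= qn k.*2)%N.
Proof.
elim: k => [//|k IH]; rewrite doubleS; have := qn_double k.*2.
by have := qn_gt0 k.*2; lia.
Qed.

Lemma qn_unbounded n : exists k, (n < qn k)%N.
Proof. by exists n.+1.*2; apply: qn_ge. Qed.

Definition convergent_error k : R := (qn k)%:R * theta - (numerator k)%:~R.
Local Notation delta := convergent_error.

(** By induction: the errors satisfy the recursion $\delta_{j+2} = a_{j+2}\delta_{j+1} + \delta_j$,
    and with $a_{j+2} = x_{j+2} - 1/x_{j+3}$ and $\delta_j = -x_{j+2}\delta_{j+1}$ only the term
    $-\delta_{j+1}/x_{j+3}$ survives. Signs, monotonicity and sizes of the errors are read off from
    this formula. *)
Lemma convergent_errorS k : delta k.+1 = - delta k / x k.+2.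
Proof.
have x0 j : x j.+1 != 0 by rewrite gt_eqF// (lt_trans ltr01)// complete_quotient_gt1.
have stp j : (a j.+1)%:~R = x j.+1 - (x j.+2)^-1.
  by rewrite -(complete_quotient_step j.+1); ring.
have stp0 : (a 0)%:~R = theta - (x 1)^-1.
  by rewrite -(complete_quotient_step 0) /x /=; ring.
have d0 : delta 0 = (x 1)^-1.
  by rewrite /delta qnRE /= stp0; ring.
have d1 : delta 1 = - delta 0 / x 2.
  have -> : delta 1 = (a 1)%:~R * theta - ((a 1)%:~R * (a 0)%:~R + 1).
    by rewrite /delta qnRE /numerator /= intrD intrM.
  rewrite d0 stp stp0; move: (x0 0%N) (x0 1%N).
  by move: (x 1%N) (x 2%N) => y z y0 z0; field; rewrite y0 z0.
suff : delta k.+1 = - delta k / x k.+2 /\ delta k.+2 = - delta k.+1 / x k.+3 by case.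
have rec j : delta j.+2 = (a j.+2)%:~R * delta j.+1 + delta j.
  by rewrite /delta !qnRE denominatorSS numeratorSS !intrD !intrM; ring.
suff H j : delta j.+1 = - delta j / x j.+2 -> delta j.+2 = - delta j.+1 / x j.+3.
  elim: k => [|k [h1 h2]]; last by split => //; apply: H.
  by split => //; apply: H.
move=> e; rewrite rec stp.
have -> : delta j = - (x j.+2 * delta j.+1) by rewrite e; field; exact: x0.
by ring.
Qed.

Lemma convergent_error_sign k : 0 < (-1) ^+ k * delta k.
Proof.
elim: k => [|k IH].
  rewrite expr0 mul1r /delta qnRE /= mul1r subr_gt0 lt_neqAle Num.Theory.floor_le andbT.
  by rewrite eq_sym; apply: irrational_neq_int.
rewrite convergent_errorS exprS.
have -> : -1 * (-1) ^+ k * (- delta k / x k.+2) = (-1) ^+ k * delta k / x k.+2 by ring.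
by rewrite divr_gt0// (lt_trans ltr01)// complete_quotient_gt1.
Qed.

Lemma norm_convergent_error k : `|delta k| = (-1) ^+ k * delta k.
Proof.
by rewrite -[RHS]ger0_norm ?(ltW (convergent_error_sign _))// normrM normrX normrN1 expr1n mul1r.
Qed.

Lemma convergent_det k :
  (qn k)%:Z * numerator k.+1 - (qn k.+1)%:Z * numerator k = (-1) ^+ k.
Proof.
elim: k => [|k IH]; first by rewrite !qnE /numerator /= -/(a 1); ring.
have -> : (-1) ^+ k.+1 = - (-1) ^+ k :> int by rewrite exprS mulN1r.
rewrite -IH numeratorSS !qnE denominatorSS; ring.
Qed.

Lemma convergent_error_norm_gt0 k : 0 < `|delta k|.
Proof. by rewrite norm_convergent_error; apply: convergent_error_sign. Qed.

(** This is the determinant identity with the numerators eliminated in favour of the errors; the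
    alternating signs turn the difference into a sum of absolute values. *)
Lemma convergent_error_identity k :
  (qn k.+1)%:R * `|delta k| + (qn k)%:R * `|delta k.+1| = 1.
Proof.
rewrite !norm_convergent_error.
have := congr1 (fun z : int => z%:~R : R) (convergent_det k).
rewrite intrB !intrM rmorphXn/= rmorphN1 => e.
have s1 : (-1) ^+ k * (-1) ^+ k = 1 :> R by rewrite -exprD addnn -mul2n exprM sqrrN !expr1n.
rewrite -[RHS]s1 -[X in _ = X * _]e /delta exprS -!(pmulrn _ (qn _)); ring.
Qed.

Lemma convergent_error_le k : `|delta k| <= (qn k.+1)%:R^-1.
Proof.
have q0 : 0 < (qn k.+1)%:R :> R by rewrite ltr0n qn_gt0.
rewrite -(ler_pM2l q0) mulfV ?gt_eqF// -[leRHS](convergent_error_identity k).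
by rewrite lerDl mulr_ge0.
Qed.

Lemma convergent_error_decr k : `|delta k.+1| <= `|delta k|.
Proof.
rewrite convergent_errorS normrM normrN normfV ler_piMr//.
have := complete_quotient_gt1 k.+1 => h; rewrite gtr0_norm ?(lt_trans ltr01)//.
by rewrite invf_le1 ?(lt_trans ltr01)// ltW.
Qed.

(** In [convergent_error_identity] the second summand is at most the first, which is therefore at
    least 1/2. *)
Lemma convergent_error_ge k : (2 * (qn k.+1)%:R)^-1 <= `|delta k|.
Proof.
have q0 : 0 < (qn k.+1)%:R :> R by rewrite ltr0n qn_gt0.
have q20 : 0 < 2 * (qn k.+1)%:R :> R by rewrite mulr_gt0.
rewrite -(ler_pM2l q20) mulfV ?gt_eqF// -[leLHS](convergent_error_identity k).
have : (qn k)%:R * `|delta k.+1| <= (qn k.+1)%:R * `|delta k|.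
  by rewrite ler_pM ?ler_nat ?qn_leS ?convergent_error_decr.
lra.
Qed.

(* In the basis of two consecutive convergents the coefficients of (m, p) have
   opposite signs, so that the two errors add up without cancellation. *)
Lemma best_approximation k (m : nat) (p : int) : (0 < m)%N -> (m < qn k.+1)%N ->
  `|delta k| <= `|m%:R * theta - p%:~R|.
Proof.
move=> m0 mq.
(* Cramer's rule for the coordinates of (m, p) in the two convergents; the determinant [s] is its
   own inverse. *)
pose s : int := (-1) ^+ k.
pose u : int := s * (m%:Z * numerator k.+1 - p * (qn k.+1)%:Z).
pose v : int := s * (p * (qn k)%:Z - m%:Z * numerator k).
have ss : s * s = 1 by rewrite /s -exprD addnn -mul2n exprM sqrrN !expr1n.
have det := convergent_det k; rewrite -/s in det.
have em : m%:Z = u * (qn k)%:Z + v * (qn k.+1)%:Z.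
  transitivity (s * s * m%:Z); first by rewrite ss mul1r.
  by rewrite -{2}det /u /v; ring.
have ep : p = u * numerator k + v * numerator k.+1.
  transitivity (s * s * p); first by rewrite ss mul1r.
  by rewrite -{2}det /u /v; ring.
clearbody u v; clear s ss det.
have -> : m%:R * theta - p%:~R = u%:~R * delta k + v%:~R * delta k.+1.
  rewrite -[m%:R]/((m%:Z)%:~R) em ep /delta !intrD !intrM; ring.
have q0 := qn_gt0 k; have q1 := qn_gt0 k.+1.
have d0 := convergent_error_norm_gt0 k; have d1 := convergent_error_norm_gt0 k.+1.
have -> : `|u%:~R * delta k + v%:~R * delta k.+1| =
          `|u%:~R * `|delta k| - v%:~R * `|delta k.+1| |.
  have nk : `|(-1) ^+ k| = 1 :> R by rewrite normrX normrN1 expr1n.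
  transitivity `|(-1) ^+ k * (u%:~R * delta k + v%:~R * delta k.+1)|.
    by rewrite normrM nk mul1r.
  rewrite !norm_convergent_error exprS; congr `|_|.
  by move: (u%:~R : R) (v%:~R : R) (delta k) (delta k.+1) => *; ring.
(* If u >= 1, then v <= 0, since otherwise m >= q_(k+1). If u <= 0, then m > 0 forces v >= 1, and m
   < q_(k+1) then forces u <= -1. *)
have [u0|u0] := leP 1 u.
  have v0 : v <= 0 by nia.
  have uR : 1 <= u%:~R :> R by rewrite ler1z.
  have vR : v%:~R <= 0 :> R by rewrite lerz0.
  apply: le_trans (ler_norm _); nra.
have v1 : 1 <= v by nia.
have u1 : u <= -1 by nia.
have uR : u%:~R <= -1 :> R by move: u1; rewrite -(ler_int R) mulrNz.
have vR : 1 <= v%:~R :> R by rewrite ler1z.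
rewrite -[leRHS]normrN; apply: le_trans (ler_norm _).
have := ler_wpM2r (ltW d0) uR; have := ler_wpM2r (ltW d1) vR; lra.
Qed.

Lemma separation k (m : nat) (p : int) : (0 < m)%N -> (m < qn k.+1)%N ->
  (2 * (qn k.+1)%:R)^-1 <= `|m%:R * theta - p%:~R|.
Proof.
by move=> m0 mq; apply: le_trans (convergent_error_ge k) _; apply: best_approximation.
Qed.

End ContinuedFraction.

(** * Translation invariance of Lebesgue measure *)

Section Translation.
Variable R : realType.
Local Notation mu := (@lebesgue_measure R).

Lemma measurable_translate (c : R) : measurable_fun [set: R] (fun s : R => s + c).
Proof.
apply: continuous_measurable_fun => x.
by apply: cvgD; [exact: cvg_id|exact: cvg_cst].
Qed.

(** The pushforward of [mu] under the translation agrees with [mu] on half-open intervals, so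
    uniqueness of Lebesgue measure applies. *)
Lemma lebesgue_measure_translate (c : R) (A : set R) : measurable A ->
  mu ((fun s : R => s + c) @^-1` A) = mu A.
Proof.
move=> mA; symmetry.
pose f : measurableTypeR R -> measurableTypeR R := fun s => s + c.
have mf : measurable_fun [set: measurableTypeR R] f by exact: measurable_translate.
pose M : {mfun _ >-> _} := mfun_Sub (mem_set mf).
rewrite (@lebesgue_measure_unique _ (pushforward mu M))//= => X [[a b] _ /= <-].
rewrite /pushforward.
have -> : f @^-1` `]a, b]%classic = `]a - c, b - c]%classic.
  by apply/seteqP; split => s /=; rewrite !in_itv/= /f ltrBlDr lerBrDr.
rewrite !lebesgue_measure_itv /= !lte_fin ltrD2r; case: ifP => // _.
by rewrite -!EFinD; congr (_%:E); ring.
Qed.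
End Translation.

(** * Zero-one law *)

Section ZeroOne.
Variables (R : realType) (theta : R).
Hypothesis htheta : irrational theta.
Local Notation mu := (@lebesgue_measure R).

(** The natural multiples of a convergent error [d] with |d| < e advance in steps shorter than e,
    hence come close to any point on the same side of 0 as [d]. *)
Lemma multiples_dense (w e : R) : 0 < e ->
  exists (n : nat) (m : int), `|w - (n%:R * theta - m%:~R)| < e.
Proof.
move=> e0.
have [k ek] : exists k, (qn theta k.+1)%:R^-1 < e.
  have [k hk] := qn_unbounded htheta (Num.truncn e^-1).
  exists k; have := qn_leS htheta k => hS.
  rewrite invf_plt ?posrE ?ltr0n ?qn_gt0//.
  apply: lt_le_trans (truncnS_gt _) _; by rewrite ler_nat (leq_trans hk).
have d0 := convergent_error_norm_gt0 htheta k.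
have dle := convergent_error_le htheta k.
move: d0 dle; set d := convergent_error theta k => d0 dle.
have dn0 : d != 0 by rewrite -normr_gt0.
(* The error [d] may have either sign, but the multiplier must be a natural number; an integer shift
   of w puts it on the side to which [d] points. *)
have [M hM] : exists M : int, 0 <= (w + M%:~R) / d.
  have [dp|dp] := ltP 0 d.
    exists (- Num.floor w); rewrite divr_ge0 ?(ltW dp)// mulrNz subr_ge0.
    exact: Num.Theory.floor_le.
  exists (- (Num.floor w + 1)); rewrite mulr_le0 ?invr_le0//.
  by rewrite mulrNz subr_le0 ltW// floorD1_gt.
pose j := Num.truncn ((w + M%:~R) / d).
exists (j * qn theta k)%N, (j%:Z * numerator theta k + M).
have -> : w - ((j * qn theta k)%:R * theta - (j%:Z * numerator theta k + M)%:~R)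
    = d * ((w + M%:~R) / d - j%:R).
  rewrite mulrBr [d * (_ / d)]mulrC divfK//.
  by rewrite natrM intrD intrM -(pmulrn _ j) /d /convergent_error; ring.
rewrite normrM; apply: le_lt_trans (ek); apply: le_trans dle.
rewrite ler_piMr// ger0_norm ?subr_ge0 ?ge_truncn ?truncn_le//.
by have := truncnS_gt ((w + M%:~R) / d); rewrite -natr1 -/j; lra.
Qed.

(** Clears the quotient from the density limit: [r *+ 2] is the measure of the ball, so near 0 the
    measure of [A] in it compares with [c * (r *+ 2)] as the density compares with [c]. *)
Lemma density_near (A : set R) (x c : R) :
  (mu (A `&` ball x r) * (mu (ball x r))^-1 @[r --> 0^'+] --> (\1_A x)%:E)%E ->
  (c < \1_A x -> \forall r \near 0^'+, ((c * (r *+ 2))%:E < mu (A `&` ball x r))%E) /\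
  (\1_A x < c -> \forall r \near 0^'+, (mu (A `&` ball x r) < (c * (r *+ 2))%:E)%E).
Proof.
move=> cv; split => cx.
  have nb : nbhs ((\1_A x)%:E : \bar R) [set y | (c%:E < y)%E].
    by apply: open_nbhs_nbhs; split; [exact: open_ereal_gt_ereal|rewrite /= lte_fin].
  have := cv _ nb; rewrite near_simpl => H; near=> r.
  have r0 : 0 < r by [].
  have : (c%:E < mu (A `&` ball x r) * (mu (ball x r))^-1)%E by near: r.
  rewrite lebesgue_measure_ball ?(ltW r0)//.
  by rewrite inver mulrn_eq0 /= gt_eqF// lte_pdivlMr ?mulrn_wgt0 // EFinM.
have nb : nbhs ((\1_A x)%:E : \bar R) [set y | (y < c%:E)%E].
  by apply: open_nbhs_nbhs; split; [exact: open_ereal_lt_ereal|rewrite /= lte_fin].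
have := cv _ nb; rewrite near_simpl => H; near=> r.
have r0 : 0 < r by [].
have : (mu (A `&` ball x r) * (mu (ball x r))^-1 < c%:E)%E by near: r.
rewrite lebesgue_measure_ball ?(ltW r0)//.
by rewrite inver mulrn_eq0 /= gt_eqF// lte_pdivrMr ?mulrn_wgt0 // EFinM.
Unshelve. all: by end_near. Qed.

(* A density point of A and a density point of its complement could be moved
   close to each other by a multiple of theta modulo 1. *)
Lemma zero_one_law (A : set R) : measurable A ->
  (forall s (m : int), A s -> A (s + m%:~R)) -> (forall s, A (s + theta) -> A s) ->
  (0 < mu A)%E -> mu.-negligible (~` A).
Proof.
move=> mA Aper Arot Apos.
have Ashift s (n : nat) (m : int) : A s -> A (s - (n%:R * theta - m%:~R)).
  move=> As; have -> : s - (n%:R * theta - m%:~R) = s - n%:R * theta + m%:~R by ring.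
  apply: Aper.
  elim: n => [|n IH]; first by rewrite mul0r subr0.
  by apply: Arot; move: IH; congr A; rewrite -natr1; ring.
have [N [mN N0 dN]] := lebesgue_density mA.
have dens y : ~ N y -> (mu (A `&` ball y r) * (mu (ball y r))^-1
    @[r --> 0^'+] --> (\1_A y)%:E)%E by move=> Ny; apply: contrapT => h; apply/Ny/dN.
have [x [Ax Nx]] : exists x, A x /\ ~ N x.
  apply: contrapT => h; have AN : A `<=` N.
    by move=> x Ax; apply: contrapT => Nx; apply: h; exists x.
  have : (mu A <= 0)%E by rewrite -N0; apply: le_measure; rewrite ?inE.
  by rewrite leNgt Apos.
exists N; split=> // /= y' nAy'; pose y : R := y'; have nAy : ~ A y by [].
rewrite -[y']/y; apply: contrapT => Ny.
have [+ _] := density_near (3/4) (dens x Nx).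
have [_ +] := density_near (1/4) (dens y Ny).
rewrite !indicE (mem_set Ax) (memNset nAy) /=.
move=> /(_ ltac:(lra)) hy /(_ ltac:(lra)) hx.
near (0 : R)^'+ => r.
have r0 : 0 < r by [].
have hyr : (mu (A `&` ball y r) < (1/4 * (r *+ 2))%:E)%E by near: r.
have hxr : ((3/4 * (r *+ 2))%:E < mu (A `&` ball x r))%E by near: r.
(* Translation by [c], within r / 4 of x - y, carries the part of A in B(x, r) into A and into B(y,
   5r/4). The larger ball adds only r / 2 to the measure, so 3r/2 < r/2 + r/2, a contradiction. *)
have [n [m nm]] := multiples_dense (x - y) (divr_gt0 r0 (ltr0n _ 4)).
pose c := n%:R * theta - m%:~R.
have mb z t : measurable (ball z t : set R) by apply: measurable_ball.
have sub : A `&` ball x r `<=`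
    (fun s : R => s - c) @^-1` ((A `&` ball y r) `|` (ball y (r + r / 4) `\` ball y r)).
  move=> s [As bs] /=.
  have Asc : A (s - c) by apply: Ashift.
  have [b|b] := pselect (ball y r (s - c)); first by left.
  right; split => //; move: bs nm; rewrite /c /ball /= !ltr_norml.
  by move=> /andP[? ?] /andP[? ?]; apply/andP; split; lra.
have mU : measurable ((A `&` ball y r) `|` (ball y (r + r / 4) `\` ball y r)).
  by apply: measurableU; [apply: measurableI|apply: measurableD].
have : (mu (A `&` ball x r) <= mu (A `&` ball y r) + (r / 2)%:E)%E.
  have le1 : (mu (A `&` ball x r) <= mu ((fun s : R => (s - c)%R) @^-1`
      ((A `&` ball y r) `|` (ball y (r + r / 4)%R `\` ball y r))))%E.
    apply: le_measure => //; rewrite inE; first by apply: measurableI; [exact: mA|exact: mb].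
    by rewrite -[X in measurable X]setTI; apply: measurable_translate.
  apply: le_trans le1 _.
  rewrite lebesgue_measure_translate//.
  have m1 : measurable (A `&` ball y r) by apply: measurableI; [exact: mA|exact: mb].
  have m2 : measurable (ball y (r + r / 4) `\` ball y r).
    by apply: measurableD; exact: mb.
  apply: (@le_trans _ _ (mu (A `&` ball y r) + mu (ball y (r + r / 4)%R `\` ball y r))%E).
    exact: measureU2.
  have fin : (mu (ball y (r + r / 4)%R) < +oo)%E.
    by rewrite lebesgue_measure_ball ?ltry//; lra.
  have -> : mu (ball y (r + r / 4) `\` ball y r) =
      (mu (ball y (r + r / 4)%R) - mu (ball y (r + r / 4)%R `&` ball y r))%E.
    by apply: measureD => //; exact: mb.
  have -> : ball y (r + r / 4) `&` ball y r = ball y r.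
    by apply/setIidr; apply: le_ball; lra.
  rewrite !lebesgue_measure_ball; [|lra|lra].
  by rewrite leeD2l// -EFinB lee_fin; lra.
move=> h; have := lt_le_trans hxr h; rewrite ltNge => /negP; apply.
apply: le_trans (leeD2r (r / 2)%:E (ltW hyr)) _.
by rewrite -EFinD lee_fin; lra.
Unshelve. all: by end_near. Qed.

End ZeroOne.

(** * Second moment inequality, separated points and windowed sums *)

(* The integral of [2 a Z <= a ^+ 2 + Z ^+ 2] over the union, where [Z] counts
   the sets to which a point belongs. *)
Lemma second_moment d (T : measurableType d) (R : realType)
    (mu : {measure set T -> \bar R}) (B : nat -> set T) (s : seq nat) (a : R) :
  0 <= a -> (forall n, measurable (B n)) ->
  ((2 * a)%:E * (\sum_(n <- s) mu (B n)) <=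
   (a ^+ 2)%:E * mu (\bigcup_(n in [set` s]) B n)
   + \sum_(n <- s) \sum_(m <- s) mu (B n `&` B m))%E.
Proof.
move=> a0 mB; set U := \bigcup_(n in _) _.
have mU : measurable U by apply: bigcup_measurable => n _; exact: mB.
have mI n m : measurable (B n `&` B m) by apply: measurableI.
have mi (A : set T) : measurable A -> measurable_fun setT (fun x => (\1_A x)%:E : \bar R).
  by move=> mA; apply/measurable_EFinP; apply: measurable_indic.
have ii (A : set T) : measurable A -> mu A = (\int[mu]_x (\1_A x)%:E)%E.
  by move=> mA; rewrite integral_indic// setIT.
have i0 (A : set T) x : (0 <= (\1_A x)%:E :> \bar R)%E by rewrite lee_fin.
have -> : (\sum_(n <- s) mu (B n) = \int[mu]_x \sum_(n <- s) (\1_(B n) x)%:E)%E.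
  rewrite ge0_integral_sum//; last by move=> n; apply: mi.
  by apply: eq_bigr => n _; apply: ii.
have -> : (\sum_(n <- s) \sum_(m <- s) mu (B n `&` B m) =
    \int[mu]_x \sum_(n <- s) \sum_(m <- s) (\1_(B n `&` B m) x)%:E)%E.
  rewrite ge0_integral_sum//; last 2 first.
  - by move=> n; apply: emeasurable_sum => m; apply: mi.
  - by move=> n x _; apply: sume_ge0.
  apply: eq_bigr => n _; rewrite ge0_integral_sum//; last by move=> m; apply: mi.
  by apply: eq_bigr => m _; apply: ii.
rewrite (ii U)// -ge0_integralZl//; last 3 first.
- by apply: emeasurable_sum => m; apply: mi.
- by move=> x _; apply: sume_ge0.
- by rewrite lee_fin mulr_ge0.
rewrite -ge0_integralZl//; last 2 first.
- exact: mi.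
- by rewrite lee_fin sqr_ge0.
rewrite -ge0_integralD//; last 4 first.
- by move=> x _; rewrite mule_ge0// lee_fin sqr_ge0.
- by apply: measurable_funeM; exact: mi.
- by move=> x _; apply: sume_ge0 => n _; apply: sume_ge0.
- by apply: emeasurable_sum => n; apply: emeasurable_sum => m; apply: mi.
apply: ge0_le_integral => //.
- move=> x _; apply: mule_ge0; first by rewrite lee_fin mulr_ge0.
  by apply: sume_ge0.
- by apply: measurable_funeM; apply: emeasurable_sum => m; apply: mi.
- apply: emeasurable_funD; first by apply: measurable_funeM; exact: mi.
  by apply: emeasurable_sum => n; apply: emeasurable_sum => m; apply: mi.
move=> x _; under [X in (_ <= _ + X)%E]eq_bigr => n _ do rewrite sumEFin.
rewrite !sumEFin -!EFinM -EFinD lee_fin.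
set Z := \sum_(n <- s) \1_(B n) x.
have -> : \sum_(n <- s) \sum_(m <- s) \1_(B n `&` B m) x = Z ^+ 2 :> R.
  rewrite expr2 big_distrl/=; apply: eq_bigr => n _.
  by rewrite big_distrr/=; apply: eq_bigr => m _; rewrite indicI.
have [Ux|nUx] := pselect (U x).
  by rewrite indicE mem_set// mulr1; have := sqr_ge0 (a - Z); rewrite sqrrB; nra.
have -> : Z = 0.
  rewrite /Z big_seq big1// => n ns; rewrite indicE memNset// => Bx.
  by apply: nUx; exists n.
by rewrite indicE memNset// !mulr0 expr0n /= addr0.
Qed.

(** Pigeonhole: [f] numbers the cells of length d that divide the interval (c - L, c + L), and
    separation allows at most one point in each cell. *)
Lemma separated_count (R : realType) (s : seq nat) (y : nat -> R) (c L d : R) :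
  0 < d -> 0 <= L -> uniq s ->
  {in s &, forall i j, i != j -> d <= `|y i - y j|} ->
  {in s, forall i, `|y i - c| < L} -> (size s)%:R <= 2 * L / d + 1.
Proof.
move=> d0 L0 us sep near_c.
pose f i := Num.truncn ((y i - (c - L)) / d).
have pos i : i \in s -> 0 <= (y i - (c - L)) / d.
  by move=> /near_c; rewrite ltr_norml => /andP[? ?]; rewrite divr_ge0 ?(ltW d0)//; lra.
have finj : {in s &, injective f}.
  move=> i j si sj ef; apply: contrapT => /eqP nij.
  have := sep i j si sj nij.
  have /andP[] := truncn_itv (pos i si); have /andP[] := truncn_itv (pos j sj).
  rewrite -/(f i) -/(f j) ef !ler_pdivlMr// !ltr_pdivrMr// -natr1 mulrDl mul1r => *.
  suff : `|y i - y j| < d by lra.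
  by rewrite ltr_norml; apply/andP; split; lra.
have L0' : 0 <= 2 * L / d by rewrite divr_ge0 ?(ltW d0)// mulr_ge0.
have : (size (map f s) <= size (iota 0 (Num.truncn (2 * L / d)).+1))%N.
  apply: uniq_leq_size; first by rewrite map_inj_in_uniq.
  move=> _ /mapP[i si ->]; rewrite mem_iota add0n ltnS /= /f; apply: le_truncn.
  rewrite ler_pM2r ?invr_gt0//; have := near_c i si.
  by rewrite ltr_norml => /andP[? ?]; lra.
rewrite size_map size_iota -(ler_nat R) -natr1 => h; apply: le_trans h _.
by rewrite lerD2r truncn_le.
Qed.

(* The weights over the window [a, a + q) are at most [r a], and [c * r (a + q)]
   is at most [c / q] times the sum of [r] over that window. *)
Lemma windowed_sum (R : realType) (r : nat -> R) (P : pred nat) (q a N : nat) (c : R) :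
  (0 < q)%N -> 0 <= c -> (forall n, 0 <= r n) ->
  (forall m n, (a <= m)%N -> (m <= n)%N -> (n < N)%N -> r n <= r m) ->
  (forall b, (a <= b)%N -> \sum_(b <= n < minn (b + q) N | P n) 1 <= c) ->
  \sum_(a <= n < N | P n) r n <= c * r a + c / q%:R * \sum_(a <= n < N) r n.
Proof.
move=> q0 c0 r0; have [k] := ubnP (N - a); elim: k a => // k IH a kN mono cnt.
have qR : 0 < q%:R :> R by rewrite ltr0n.
have cq : 0 <= c / q%:R by rewrite divr_ge0.
have win : \sum_(a <= n < minn (a + q) N | P n) r n <= c * r a.
  apply: (@le_trans _ _ (\sum_(a <= n < minn (a + q) N | P n) 1 * r a)).
    rewrite big_nat_cond [leRHS]big_nat_cond; apply: ler_sum => n /andP[/andP[an]].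
    rewrite leq_min => /andP[nq nN] _; rewrite mul1r; exact: mono.
  by rewrite -mulr_suml ler_wpM2r// cnt.
(* A last, possibly incomplete window ends the induction; otherwise the next window starts at a + q,
   and its leading term is paid for by the window [a, a + q). *)
have [Nq|qN] := leqP N (a + q).
  move: win; rewrite (minn_idPr Nq) => win; apply: le_trans win _.
  by rewrite lerDl mulr_ge0// sumr_ge0.
move: win; rewrite (minn_idPl (ltnW qN)) => win.
have aq : (a <= a + q)%N by apply: leq_addr.
rewrite (big_cat_nat aq (ltnW qN))/= [X in c / _ * X](big_cat_nat aq (ltnW qN))/=.
have := IH (a + q)%N; move=> /(_ _ _ _)/wrap[].
- by lia.
- by move=> m n am; apply: mono; lia.
- by move=> b ab; apply: cnt; lia.
move=> IH'.
have : c * r (a + q)%N <= c / q%:R * \sum_(a <= n < a + q) r n.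
  rewrite -mulrA ler_wpM2l// ler_pdivlMl//.
  have -> : q%:R * r (a + q)%N = \sum_(a <= n < a + q) r (a + q)%N.
    by rewrite sumr_const_nat addKn mulr_natl.
  by rewrite [leLHS]big_nat [leRHS]big_nat; apply: ler_sum => n /andP[? ?]; apply: mono; lia.
rewrite mulrDr; lra.
Qed.

Lemma sum_square_symmetric (R : realType) (w : nat -> nat -> R) (M N : nat) :
  (forall m n, w m n = w n m) -> (M <= N)%N ->
  \sum_(M <= n < N) \sum_(M <= m < N) w n m =
  \sum_(M <= n < N) (w n n + 2 * \sum_(M <= m < n) w m n).
Proof.
move=> ws; elim: N => [|N IH].
  by rewrite leqn0 => /eqP ->; rewrite !big_geq//.
rewrite leq_eqVlt => /predU1P[<-|]; first by rewrite !big_geq//.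
rewrite ltnS => MN; rewrite !big_nat_recr//= -IH//.
have -> : \sum_(M <= n < N) \sum_(M <= m < N.+1) w n m =
    \sum_(M <= n < N) \sum_(M <= m < N) w n m + \sum_(M <= n < N) w n N.
  by rewrite -big_split/=; apply: eq_bigr => n _; rewrite big_nat_recr.
have -> : \sum_(M <= m < N) w N m = \sum_(M <= m < N) w m N.
  by apply: eq_bigr => m _; apply: ws.
by ring.
Qed.

Definition frac_multiple (R : realType) (theta : R) (n : nat) : R :=
  n%:R * theta - (Num.floor (n%:R * theta))%:~R.

Lemma frac_multiple_itv (R : realType) (theta : R) n :
  0 <= frac_multiple theta n < 1.
Proof.
rewrite /frac_multiple subr_ge0 Num.Theory.floor_le /=.
by have := floorD1_gt (n%:R * theta); rewrite intrD; lra.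
Qed.

Lemma sum_qn_blocks (R : realType) (theta : R) (f : nat -> R) a b :
  irrational theta -> (a <= b)%N ->
  \sum_(qn theta a <= n < qn theta b) f n =
  \sum_(a <= i < b) \sum_(qn theta i <= n < qn theta i.+1) f n.
Proof.
move=> htheta; elim: b => [|b IH]; first by rewrite leqn0 => /eqP ->; rewrite !big_geq.
rewrite leq_eqVlt => /predU1P[<-|]; first by rewrite !big_geq.
rewrite ltnS => ab; rewrite big_nat_recr//= -IH// -big_cat_nat//=.
  exact: qn_homo.
exact: qn_leS.
Qed.

(** * Second moment of the number of balls *)

Section DivergencePart.
Variables (R : realType) (theta : R) (r : nat -> R).
Hypothesis htheta : irrational theta.
Hypothesis r_ge0 : forall n, 0 <= r n.
Hypothesis r_noninc : forall m n, (0 < m)%N -> (m <= n)%N -> r n <= r m.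
Hypothesis r_separated : forall i n,
  (qn theta i <= n)%N -> (n < qn theta i.+1)%N -> r n <= (4 * (qn theta i.+1)%:R)^-1.
Hypothesis r_le1 : forall n, r n <= 1.
Hypothesis r_le_inv : forall n, n%:R * r n <= 1.

Local Notation mu := (@lebesgue_measure R).
Local Notation q := (qn theta).
Local Notation x := (frac_multiple theta).
Local Notation B := (fun n => ball (x n) (r n) : set R).

Lemma frac_multiple_separated k m n : (m < n)%N -> (n - m < q k.+1)%N ->
  (2 * (q k.+1)%:R)^-1 <= `|x n - x m|.
Proof.
move=> mn nmq.
have -> : x n - x m = (n - m)%:R * theta -
    (Num.floor (n%:R * theta) - Num.floor (m%:R * theta))%:~R.
  by rewrite /frac_multiple natrB ?(ltnW mn)// intrB; ring.
by apply: separation => //; rewrite subn_gt0.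
Qed.

Lemma measure_ballI_fin n m : mu (B n `&` B m) \is a fin_num.
Proof.
rewrite ge0_fin_numE ?measure_ge0//.
apply: (@le_lt_trans _ _ (mu (B n))).
  apply: le_measure; rewrite ?inE; [|exact: measurable_ball|exact: subIsetl].
  by apply: measurableI; exact: measurable_ball.
by rewrite lebesgue_measure_ball ?ltry.
Qed.

Let w n m : R := fine (mu (B n `&` B m)).

Let wE n m : mu (B n `&` B m) = (w n m)%:E.
Proof. by rewrite /w fineK// measure_ballI_fin. Qed.

Let w_sym n m : w n m = w m n.
Proof. by rewrite /w setIC. Qed.

Let w_le n m : w n m <= 2 * r m.
Proof.
rewrite -lee_fin -wE.
apply: (@le_trans _ _ (mu (B m))).
  apply: le_measure; rewrite ?inE; [|exact: measurable_ball|exact: subIsetr].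
  by apply: measurableI; exact: measurable_ball.
by rewrite lebesgue_measure_ball// lee_fin mulr_natl.
Qed.

Let w_far n m : r n + r m <= `|x n - x m| -> w n m = 0.
Proof.
move=> far; rewrite /w; have -> : B n `&` B m = set0; last by rewrite measure0.
rewrite -subset0 => s [] /=; rewrite /ball/= => h1 h2.
have := ler_distD s (x n) (x m); rewrite [`|s - x m|]distrC; lra.
Qed.

Let w_diag n : w n n = 2 * r n.
Proof. by rewrite /w setIid lebesgue_measure_ball//= mulr_natl. Qed.

(** Both radii are at most a quarter of 1 / q_(l+1), while the centres are at distance at least half
    of it. *)
Let w_same_block l m n : (q l <= m)%N -> (m < n)%N -> (n < q l.+1)%N -> w m n = 0.
Proof.
move=> lm mn nl; rewrite w_sym; apply: w_far.
apply: le_trans _ (@frac_multiple_separated l _ _ mn _); last by lia.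
have hn := r_separated (leq_trans lm (ltnW mn)) nl.
have hm := r_separated lm (ltn_trans mn nl).
by move: hn hm; rewrite !invfM; lra.
Qed.

Let blockS l : R := \sum_(q l <= n < q l.+1) r n.

(** As r is nonincreasing, a ball of the block that meets [B n] has its centre within 2 r_n of x_n.
    A window of length Q = q_(k+1) has centres 1 / (2 Q) apart, hence contains at most 8 Q r_n + 1
    such balls; [windowed_sum] adds up the windows. *)
Lemma overlap_block k n : (0 < n)%N -> (n < q k.+1)%N ->
  \sum_(q k.+1 <= m < q k.+2) w n m <=
  (8 * (q k.+1)%:R * r n + 1) * (2 * r (q k.+1) + 2 / (q k.+1)%:R * blockS k.+1).
Proof.
move=> n0 nq; set Q := q k.+1; have Q0 : (0 < Q)%N by apply: qn_gt0.
have QR : 0 < Q%:R :> R by rewrite ltr0n.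
pose P m := `|x m - x n| < 2 * r n.
apply: (@le_trans _ _ (\sum_(Q <= m < q k.+2 | P m) (2 * r m))).
  rewrite big_nat [leRHS]big_nat_cond [leRHS]big_mkcondr/=.
  apply: ler_sum => m /andP[mQ mq]; case: ifPn => [_|]; first exact: w_le.
  rewrite -leNgt => far; rewrite w_far// distrC; apply: le_trans far.
  have : r m <= r n by apply: r_noninc => //; lia.
  lra.
have c0 : 0 <= 8 * Q%:R * r n + 1 by rewrite addr_ge0// !mulr_ge0.
have -> : (8 * Q%:R * r n + 1) * (2 * r Q + 2 / Q%:R * blockS k.+1) =
    (8 * Q%:R * r n + 1) * (2 * r Q) +
    (8 * Q%:R * r n + 1) / Q%:R * \sum_(Q <= m < q k.+2) (2 * r m).
  by rewrite -mulr_sumr /blockS; field; rewrite gt_eqF.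
apply: (@windowed_sum R (fun m => 2 * r m)) => //.
- by move=> m; rewrite mulr_ge0.
- by move=> i j Qi ij _; rewrite ler_wpM2l// r_noninc//; lia.
move=> b Qb; rewrite -big_filter -[\sum_(_ <- _) 1]/(\sum_(_ <- _ | true) 1%:R).
rewrite -natr_sum sum1_size.
set s := [seq _ <- _ | _].
have ss : {in s, forall i, [/\ P i, (b <= i)%N & (i < b + Q)%N]}.
  by move=> i; rewrite mem_filter mem_index_iota leq_min => /andP[? /andP[? /andP[? _]]].
have -> : 8 * Q%:R * r n + 1 = 2 * (2 * r n) / (2 * Q%:R)^-1 + 1.
  by rewrite invrK; ring.
apply: (@separated_count _ s x (x n)).
- by rewrite invr_gt0 mulr_gt0.
- by rewrite mulr_ge0.
- by rewrite filter_uniq// iota_uniq.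
- move=> i j /ss[_ bi ib] /ss[_ bj jb] ij.
  wlog ij' : i j bi ib bj jb ij / (j < i)%N.
    move=> H; have [h|h] : (i < j)%N \/ (j < i)%N by lia.
      by rewrite distrC; apply: H => //; rewrite eq_sym.
    exact: H.
  by apply: frac_multiple_separated => //; rewrite -/Q; lia.
- by move=> i /ss[].
Qed.

Let sumq l0 l : R := \sum_(q l0 <= n < q l) r n.

Let sumq_cat l0 l1 l2 : (l0 <= l1)%N -> (l1 <= l2)%N ->
  sumq l0 l2 = sumq l0 l1 + sumq l1 l2.
Proof. by move=> ? ?; rewrite /sumq -big_cat_nat//=; apply: qn_homo. Qed.

Let sumq_ge0 l0 l : 0 <= sumq l0 l.
Proof. by apply: sumr_ge0. Qed.

(** The first two terms are at most 1 each. For the others, q_l >= 2 q_(l-2) and monotonicity bound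
    q_l r(q_l) by twice the sum of r over [q_(l-2), q_l); each block is used at most twice. *)
Lemma block_start_sum l0 m :
  \sum_(l0 <= l < l0 + m.+2) (q l)%:R * r (q l) <=
  2 + 2 * sumq l0 (l0 + m.+1) + 2 * sumq l0 (l0 + m).
Proof.
elim: m => [|m IH].
  rewrite addn2 big_nat_recr ?leqnSn//= big_nat1 addn0.
  have := r_le_inv (q l0); have := r_le_inv (q l0.+1).
  have := sumq_ge0 l0 (l0 + 1); have := sumq_ge0 l0 l0; lra.
rewrite [(l0 + m.+3)%N]addnS big_nat_recr/=; last by lia.
have : (q (l0 + m.+2))%:R * r (q (l0 + m.+2)) <= 2 * sumq (l0 + m) (l0 + m.+2).
  have q2 := qn_double htheta (l0 + m); rewrite -!addnS in q2.
  have : sumq (l0 + m) (l0 + m.+2) >=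
      (q (l0 + m.+2) - q (l0 + m))%:R * r (q (l0 + m.+2)).
    rewrite mulr_natl -sumr_const_nat /sumq big_nat [leRHS]big_nat.
    apply: ler_sum => n /andP[h1 h2]; apply: r_noninc; last by lia.
    by have := qn_gt0 htheta (l0 + m); lia.
  rewrite natrB; last by lia.
  have : (2 * q (l0 + m))%:R <= (q (l0 + m.+2))%:R :> R by rewrite ler_nat.
  rewrite natrM; have := r_ge0 (q (l0 + m.+2)); nra.
have := @sumq_cat l0 (l0 + m) (l0 + m.+2) _ _; move=> /(_ ltac:(lia) ltac:(lia)) ->.
move: IH; lra.
Qed.

(** Only pairs from different blocks overlap. Summing [overlap_block] over all earlier n gives (8 S
    + 1)(2 q_l r(q_l) + 2 [blockS] l) for block l, and [block_start_sum] then gives (8 S + 1)(10 S +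
    4) <= 9 S * 14 S, where S >= 1 is used. *)
Lemma overlap_sum k0 m : 1 <= sumq k0.+1 (k0.+1 + m.+2) ->
  \sum_(q k0.+1 <= n' < q (k0.+1 + m.+2)) \sum_(q k0.+1 <= n < n') w n n' <=
  126 * sumq k0.+1 (k0.+1 + m.+2) ^+ 2.
Proof.
set l0 := k0.+1; set l1 := (l0 + m.+2)%N; move=> S1.
have l01 : (l0 <= l1)%N by rewrite leq_addr.
rewrite sum_qn_blocks//.
set S := sumq l0 l1 in S1 *.
apply: (@le_trans _ _ (\sum_(l0 <= l < l1)
    (8 * S + 1) * (2 * ((q l)%:R * r (q l)) + 2 * blockS l))); last first.
  rewrite -mulr_sumr big_split/= -!mulr_sumr /blockS -sum_qn_blocks// -/(sumq l0 l1) -/S.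
  have := block_start_sum l0 m; rewrite -/l1.
  have : sumq l0 (l0 + m.+1) <= S.
    by rewrite /S (@sumq_cat l0 (l0 + m.+1) l1) ?lerDl//; rewrite /l1; lia.
  have : sumq l0 (l0 + m) <= S.
    by rewrite /S (@sumq_cat l0 (l0 + m) l1) ?lerDl//; rewrite /l1; lia.
  move: (\sum_(l0 <= l < l1) _) => V h1 h2 h3.
  have hV : V <= 2 + 4 * S by lra.
  have hV' : 2 * V + 2 * S <= 14 * S by lra.
  have S8 : 8 * S + 1 <= 9 * S by lra.
  apply: (@le_trans _ _ ((8 * S + 1) * (14 * S))); first by rewrite ler_wpM2l//; lra.
  apply: (@le_trans _ _ ((9 * S) * (14 * S))); first by rewrite ler_wpM2r//; lra.
  by rewrite expr2; lra.
rewrite big_nat [leRHS]big_nat; apply: ler_sum => l /andP[l0l ll1].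
have -> : \sum_(q l <= n' < q l.+1) \sum_(q l0 <= n < n') w n n' =
    \sum_(q l <= n' < q l.+1) \sum_(q l0 <= n < q l) w n n'.
  apply: eq_big_nat => n' /andP[h1 h2].
  rewrite (@big_cat_nat _ _ _ (q l))//=; last by apply: qn_homo.
  rewrite [X in _ + X](_ : _ = 0) ?addr0// big_nat; apply: big1 => n /andP[h3 h4].
  exact: (@w_same_block l).
rewrite exchange_big/=.
have [k ek] : exists k, l = k.+1 by exists l.-1; lia.
rewrite ek; have Q0 : (0 < q k.+1)%N by apply: qn_gt0.
have QR : 0 < (q k.+1)%:R :> R by rewrite ltr0n.
apply: (@le_trans _ _ (\sum_(q l0 <= n < q k.+1)
  (8 * (q k.+1)%:R * r n + 1) * (2 * r (q k.+1) + 2 / (q k.+1)%:R * blockS k.+1))).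
  rewrite big_nat [leRHS]big_nat; apply: ler_sum => n /andP[h1 h2].
  by apply: overlap_block => //; have := qn_gt0 htheta l0; lia.
rewrite -mulr_suml big_split/= -mulr_sumr sumr_const_nat.
have -> : 2 * r (q k.+1) + 2 / (q k.+1)%:R * blockS k.+1 =
    (2 * ((q k.+1)%:R * r (q k.+1)) + 2 * blockS k.+1) / (q k.+1)%:R.
  by field; rewrite gt_eqF.
rewrite mulrA mulrAC ler_wpM2r//.
  by rewrite addr_ge0// mulr_ge0// ?mulr_ge0//; apply: sumr_ge0.
rewrite ler_pdivrMr//.
have : \sum_(q l0 <= n < q k.+1) r n <= S.
  by rewrite /S (@sumq_cat l0 k.+1 l1) ?lerDl//; lia.
have : (q k.+1 - q l0)%:R <= (q k.+1)%:R :> R by rewrite ler_nat leq_subr.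
move: (\sum_(_ <= _ < _) _) => V; nra.
Qed.

(** The measures of the balls add up to 2 S and those of all ordered pairwise intersections to at
    most 2 S + 252 S^2 <= 254 S^2. The choice a = 127 S in [second_moment] is the quotient of these
    two bounds, and yields the lower bound 254 / 127^2. *)
Lemma union_measure_ge k0 m : 1 <= sumq k0.+1 (k0.+1 + m.+2) ->
  ((2 / 127)%:E <= mu (\bigcup_(n >= q k0.+1) B n))%E.
Proof.
move=> S1; have := overlap_sum S1.
set M := q k0.+1; set N := q (k0.+1 + m.+2); set S := sumq k0.+1 (k0.+1 + m.+2) in S1 * => ov.
have mB n : measurable (B n) by exact: measurable_ball.
have MN : (M <= N)%N by apply: qn_homo => //; rewrite leq_addr.
have S127 : 0 <= 127 * S by lra.
set U := \bigcup_(n in [set` index_iota M N]) B n.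
have h : ((2 * (127 * S))%:E * (\sum_(M <= n < N) mu (B n)) <=
    ((127 * S) ^+ 2)%:E * mu U + \sum_(M <= n < N) \sum_(M <= m < N) mu (B n `&` B m))%E.
  exact: second_moment.
have e1 : (\sum_(M <= n < N) mu (B n) = (2 * S)%:E)%E.
  rewrite /S /sumq mulr_sumr -sumEFin; apply: eq_bigr => n _.
  by rewrite lebesgue_measure_ball// mulr_natl.
have e2 : (\sum_(M <= n < N) \sum_(M <= m < N) mu (B n `&` B m) =
    (\sum_(M <= n < N) \sum_(M <= m < N) w n m)%:E)%E.
  rewrite -sumEFin; apply: eq_bigr => n _; rewrite -sumEFin; apply: eq_bigr => n' _.
  exact: wE.
have e3 : \sum_(M <= n < N) \sum_(M <= m < N) w n m <= 254 * S ^+ 2.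
  rewrite sum_square_symmetric// big_split/= -mulr_sumr.
  under eq_bigr => n _ do rewrite w_diag.
  rewrite -mulr_sumr -/(sumq k0.+1 (k0.+1 + m.+2)) -/S.
  have S2 : S <= S ^+ 2 by rewrite expr2 ler_peMl// (le_trans ler01).
  by move: ov; lra.
rewrite e1 e2 in h.
have UV : (mu U <= mu (\bigcup_(n >= M) B n))%E.
  apply: le_measure; rewrite ?inE.
  - by apply: bigcup_measurable => n _; exact: mB.
  - by apply: bigcup_measurable => n _; exact: mB.
  by apply: bigcup_sub => n /=; rewrite mem_index_iota => /andP[Mn _] s Bs; exists n.
have U0 : (0 <= mu U)%E by exact: measure_ge0.
apply: le_trans UV; case: (mu U) h U0 => [u|_ _|//]; last exact: leey.
rewrite -!EFinM -!EFinD !lee_fin => h u0.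
have S20 : 0 < S ^+ 2 by rewrite exprn_gt0// (lt_le_trans ltr01).
have h' : 254 * S ^+ 2 <= 127 ^+ 2 * u * S ^+ 2.
  by move: h e3; rewrite exprMn !expr2; lra.
by move: h'; rewrite ler_pM2r// ler_pdivrMr// !expr2; lra.
Qed.

(** The unions of the tails decrease, stay in a bounded set and have measure at least 2 / 127, so
    continuity from above passes the bound to the limsup set. *)
Lemma limsup_balls_positive :
  (forall l0, exists2 l1, (l0 <= l1)%N & 1 <= \sum_(q l0 <= n < q l1) r n) ->
  (0 < mu (lim_sup_set (fun n => ball (x n) (r n) : set R)))%E.
Proof.
move=> div.
have mB n : measurable (B n) by exact: measurable_ball.
have big k : ((2 / 127)%:E <= mu (\bigcup_(n >= k) B n))%E.
  have [k0 hk] : exists k0, (k <= q k0.+1)%N.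
    have [k0 h] := qn_unbounded htheta k; exists k0.
    by rewrite (leq_trans (ltnW h))// qn_leS.
  have [l1 l01 S1] := div k0.+1.
  apply: (@le_trans _ _ (mu (\bigcup_(n >= q k0.+1) B n))).
    apply: (@union_measure_ge k0 (l1 - k0.+1)); apply: le_trans S1 _.
    have l12 : (l1 <= k0.+1 + (l1 - k0.+1).+2)%N by lia.
    by rewrite (sumq_cat l01 l12) lerDl.
  apply: le_measure; rewrite ?inE; try by apply: bigcup_measurable => n _; exact: mB.
  by apply: bigcup_sub => n /= kn s Bs; exists n => //=; apply: leq_trans kn.
have fin : (mu (\bigcup_(n >= 0) B n) < +oo)%E.
  apply: (@le_lt_trans _ _ (mu (ball 0 (3:R)))).
    apply: le_measure; rewrite ?inE; [|exact: measurable_ball|].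
      by apply: bigcup_measurable => n _; exact: mB.
    apply: bigcup_sub => n _ s; rewrite /ball/= => Bs.
    have /andP[x0 x1] := frac_multiple_itv theta n.
    have rn := r_le1 n.
    move: Bs; rewrite sub0r normrN !ltr_norml => /andP[? ?]; apply/andP; split; lra.
  by rewrite lebesgue_measure_ball// ltry.
have cv := lim_sup_set_cvg mu _ mB fin.
apply: (@lt_le_trans _ _ (2 / 127)%:E); first by rewrite lte_fin; lra.
rewrite -(cvg_lim _ cv)//; apply: lime_ge; first by apply/cvg_ex; eexists; exact: cv.
exact: nearW.
Qed.

End DivergencePart.

(** * Measurability, invariance and fullness of the set W *)

Lemma infinite_natP (A : set nat) :
  infinite_set A <-> forall N, exists2 n, (N <= n)%N & A n.
Proof.
split=> [infA N|H finA].
  apply: contrapT => h; apply: infA; apply: (sub_finite_set _ (finite_II N)) => n An /=.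
  by rewrite ltnNge; apply/negP => Nn; apply: h; exists n.
have /finite_seqP[s es] := finA.
have [n] := H (\max_(i <- s) i).+1; rewrite es /= => h ns.
by have := @leq_bigmax_seq _ s xpredT id n ns isT; rewrite leqNgt h.
Qed.

Section TwistedSet.
Variables (R : realType) (theta : R).
Implicit Types (psi : nat -> R) (s : R).
Local Notation mu := (@lebesgue_measure R).

Lemma dist_int_ltP (y e : R) : dist_int y < e <-> exists p : int, `|y - p%:~R| < e.
Proof.
split=> [|[p yp]].
  move=> /inf_lt[]; first by exists `|y - 0%:~R|; exists 0.
  by move=> _ [p _ <-] yp; exists p.
apply: le_lt_trans yp; apply: ge_inf; last by exists p.
by exists 0 => _ [m _ <-].
Qed.

Lemma WP psi s : W theta psi s <-> forall N, exists2 n, (N <= n)%N &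
  (0 < n)%N /\ exists p : int, `|n%:R * theta - s - p%:~R| < psi n.
Proof.
rewrite /W /=; split => [/infinite_natP H N|H].
  by have [n Nn [n0 /dist_int_ltP]] := H N; exists n.
apply/infinite_natP => N; have [n Nn [n0 /dist_int_ltP ?]] := H N.
by exists n.
Qed.

Lemma W_translate_int psi s (m : int) : W theta psi s -> W theta psi (s + m%:~R).
Proof.
move=> /WP H; apply/WP => N; have [n Nn [n0 [p hp]]] := H N.
exists n => //; split => //; exists (p - m).
by apply: le_lt_trans hp; rewrite intrB le_eqVlt; apply/orP; left; apply/eqP; congr `|_|; ring.
Qed.

Lemma W_translate psi s : (forall m n, (0 < m)%N -> (m <= n)%N -> psi n <= psi m) ->
  W theta psi (s + theta) -> W theta psi s.
Proof.
(* If n approximates s + theta, then n - 1 approximates s; starting from [N.+2] keeps n - 1 positive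
   and at least N. *)
move=> mono /WP H; apply/WP => N; have [n Nn [n0 [p hp]]] := H N.+2.
exists n.-1; first by lia.
split; first by lia.
have e : n%:R = n.-1%:R + 1 :> R by rewrite -[in LHS](prednK n0) natr1.
exists p; apply: lt_le_trans (mono n.-1 n _ _); [|lia..].
apply: le_lt_trans hp; rewrite e le_eqVlt; apply/orP; left; apply/eqP; congr `|_|; ring.
Qed.

Lemma measurable_W psi : measurable (W theta psi).
Proof.
(* The integers p are split into [Posz] and [Negz], so that the countable union runs over the
   naturals. *)
have -> : W theta psi = \bigcap_N \bigcup_(n in [set n | (N <= n)%N /\ (0 < n)%N])
    \bigcup_p (ball (n%:R * theta - (Posz p)%:~R) (psi n) `|`
    ball (n%:R * theta - (Negz p)%:~R) (psi n)).
  apply/seteqP; split => s.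
    move=> /WP H N _; have [n Nn [n0 [p hp]]] := H N; exists n => //.
    by case: p hp => p hp; exists p => //; [left|right]; rewrite /ball/= addrAC.
  move=> H; apply/WP => N; have [n [Nn n0] [p _ hp]] := H N I; exists n => //; split=> //.
  case: hp => hp; first by exists (Posz p); move: hp; rewrite /ball/= addrAC.
  by exists (Negz p); move: hp; rewrite /ball/= addrAC.
apply: bigcap_measurable => // N _; apply: bigcup_measurable => n _.
by apply: bigcup_measurable => p _; apply: measurableU; apply: measurable_ball.
Qed.

(** The limsup set of the balls of radius r_n <= psi(n) has positive measure and lies in W, to which
    the zero-one law applies. *)
Lemma W_full psi (r : nat -> R) : irrational theta ->
  (forall m n, (0 < m)%N -> (m <= n)%N -> psi n <= psi m) ->
  (forall n, (0 < n)%N -> r n <= psi n) ->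
  (forall n, 0 <= r n) ->
  (forall m n, (0 < m)%N -> (m <= n)%N -> r n <= r m) ->
  (forall i n, (qn theta i <= n)%N -> (n < qn theta i.+1)%N ->
    r n <= (4 * (qn theta i.+1)%:R)^-1) ->
  (forall n, r n <= 1) -> (forall n, n%:R * r n <= 1) ->
  (forall l0, exists2 l1, (l0 <= l1)%N &
    1 <= \sum_(qn theta l0 <= n < qn theta l1) r n) ->
  full_measure (W theta psi).
Proof.
move=> htheta psimono rpsi r0 rmono rsep r1 rinv div.
apply: (zero_one_law htheta); first exact: measurable_W.
- by move=> s m; apply: W_translate_int.
- by move=> s; apply: W_translate.
apply: lt_le_trans (limsup_balls_positive htheta r0 rmono rsep r1 rinv div) _.
apply: le_measure; rewrite ?inE.
- apply: bigcap_measurable => // N _; apply: bigcup_measurable => n _.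
  exact: measurable_ball.
- exact: measurable_W.
move=> s H; apply/WP => N; have [n /= Nn Bs] := H N.+1 I.
exists n; first by lia.
have n0 : (0 < n)%N by lia.
split => //; exists (Num.floor (n%:R * theta)).
by apply: lt_le_trans (rpsi n n0); move: Bs; rewrite /ball/= /frac_multiple addrAC.
Qed.

End TwistedSet.

(** * Harmonic sums, truncated sums and upper limits *)

Section RealLemmas.
Variable R : realType.
Implicit Types (x y c l : R) (s : seq R).

Lemma ln_div_telescope (q : nat -> R) a b : (forall n, 0 < q n) -> (a <= b)%N ->
  \sum_(a <= n < b) ln (q n.+1 / q n) = ln (q b) - ln (q a).
Proof.
move=> q0 ab; rewrite -(telescope_sumr (fun n => ln (q n)) ab).
by apply: eq_bigr => n _; rewrite ln_div ?posrE.
Qed.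

Lemma ln_nat_telescope (a b : nat) : (0 < a)%N -> (a <= b)%N ->
  \sum_(a <= n < b) ln (1 + n%:R^-1) = ln (b%:R / a%:R) :> R.
Proof.
move=> a0 ab; rewrite ln_div ?posrE ?ltr0n//; last by lia.
rewrite -(telescope_sumr (fun n => ln (n%:R : R)) ab) big_nat [RHS]big_nat.
apply: eq_bigr => n /andP[an _]; have n0 : (0 < n)%N by lia.
rewrite -ln_div ?posrE ?ltr0n//; congr ln; rewrite -natr1 mulrDl mul1r mulfV//.
by rewrite pnatr_eq0; lia.
Qed.

Lemma harmonic_ge (a b : nat) : (0 < a)%N -> (a <= b)%N ->
  ln (b%:R / a%:R) <= \sum_(a <= n < b) n%:R^-1 :> R.
Proof.
move=> a0 ab; rewrite -ln_nat_telescope//; apply: ler_sum => n _.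
by apply: le_ln1Dx; apply: (@lt_le_trans _ _ 0); rewrite ?ltrN10// invr_ge0.
Qed.

(** The inequality ln (1 + y) <= y is used at y = - x / (1 + x), where 1 + y is the inverse of 1 +
    x. *)
Lemma ln1D_ge_half x : 0 <= x <= 1 -> x / 2 <= ln (1 + x).
Proof.
move=> /andP[x0 x1]; have p : 0 < 1 + x by lra.
have := @le_ln1Dx R (- (x / (1 + x))).
have -> : 1 + - (x / (1 + x)) = (1 + x)^-1 by field; rewrite gt_eqF.
rewrite lnV ?posrE// lerN2 => h; apply: le_trans (h _).
  by rewrite ler_wpM2l// lef_pV2 ?posrE//; lra.
by rewrite ltrN2 ltr_pdivrMr//; lra.
Qed.

Lemma harmonic_le (a b : nat) : (0 < a)%N -> (a <= b)%N ->
  \sum_(a <= n < b) n%:R^-1 <= 2 * ln (b%:R / a%:R) :> R.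
Proof.
move=> a0 ab; rewrite -ln_nat_telescope// mulr_sumr big_nat [leRHS]big_nat.
apply: ler_sum => n /andP[an _].
have n1 : 1 <= n%:R :> R by rewrite ler1n; lia.
have : n%:R^-1 / 2 <= ln (1 + n%:R^-1) :> R.
  by apply: ln1D_ge_half; rewrite invr_ge0 ler0n invf_le1//; lra.
lra.
Qed.

(** With y the square root of x, ln x = 2 ln y <= 2 y <= c y^2 once y >= 2 / c. *)
Lemma ln_le_mul c : 0 < c -> exists2 x0, 0 < x0 & forall x, x0 <= x -> ln x <= c * x.
Proof.
move=> c0; exists ((2 / c) ^+ 2); first by rewrite exprn_gt0// divr_gt0.
move=> x hx; have x0 : 0 < x by apply: lt_le_trans hx; rewrite exprn_gt0// divr_gt0.
pose y := Num.sqrt x; have y0 : 0 < y by rewrite sqrtr_gt0.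
have ey : x = y ^+ 2 by rewrite sqr_sqrtr// ltW.
have hy : 2 / c <= y.
  by rewrite -ler_sqr ?nnegrE ?(ltW y0) ?divr_ge0 ?(ltW c0)// -ey.
rewrite ey lnXn// mulr2n; have := ln_sublinear y0.
have : 2 * y <= c * y ^+ 2.
  rewrite expr2 mulrA ler_pM2r//; move: hy; rewrite ler_pdivrMr//; lra.
lra.
Qed.

Lemma sum_sort_take_drop (f : R -> R) s N :
  \sum_(x <- s) f x = \sum_(x <- take N (sort >=%R s)) f x
    + \sum_(x <- drop N (sort >=%R s)) f x.
Proof.
rewrite -big_cat cat_take_drop; apply: perm_big.
by rewrite perm_sym perm_sort.
Qed.

(** Each of the largest entries counts for at most l, each other one for at most itself. *)
Lemma sum_min_le s l (alpha : R) : 0 <= l ->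
  \sum_(x <- s) Num.min x l <=
  (Num.truncn alpha)%:R * l + (\sum_(x <- s) x - sum_largest s alpha).
Proof.
move=> l0; rewrite /sum_largest; set N := Num.truncn alpha.
rewrite (sum_sort_take_drop _ s N) (sum_sort_take_drop id s N) addrAC subrr add0r.
apply: lerD; last by apply: ler_sum => x _; rewrite ge_min lexx.
apply: (@le_trans _ _ (\sum_(x <- take N (sort >=%R s)) l)).
  by apply: ler_sum => x _; rewrite ge_min lexx orbT.
rewrite big_const_seq count_predT iter_addr_0 -[l *+ _]mulr_natl.
by rewrite ler_wpM2r// ler_nat size_take_min geq_minl.
Qed.

(** If the N largest entries exist and are all at least l, they contribute N l. Otherwise either no
    entry is left, or one of the N largest is below l and truncation leaves all the remaining
    entries unchanged. *)
Lemma sum_min_ge s l (alpha : R) : {in s, forall x, 0 <= x} -> 0 <= l ->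
  (Num.truncn alpha)%:R * l <= \sum_(x <- s) Num.min x l \/
  \sum_(x <- s) x - sum_largest s alpha <= \sum_(x <- s) Num.min x l.
Proof.
move=> s0 l0; rewrite /sum_largest; set N := Num.truncn alpha.
rewrite !(sum_sort_take_drop _ s N) [X in X - _]addrC addrK.
set S := sort _ s; have S0 : {in S, forall x, 0 <= x}.
  by move=> x; rewrite mem_sort; apply: s0.
have pos (t : seq R) : {subset t <= S} -> 0 <= \sum_(x <- t) Num.min x l.
  by move=> ts; rewrite big_seq; apply: sumr_ge0 => x /ts/S0 x0; rewrite le_min x0.
have pT := pos _ (mem_take (n0 := N) (s := S)).
have pD := pos _ (mem_drop (n0 := N) (s := S)).
have [big|small] := pselect ({in take N S, forall x, l <= x}).
  have [NS|SN] := leqP N (size S); last first.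
    right; rewrite (drop_oversize (ltnW SN)) !big_nil addr0; exact: pT.
  left; rewrite -[leLHS]addr0; apply: lerD => //.
  rewrite big_seq (eq_bigr (fun=> l)); last by move=> x /big h; apply/min_idPr.
  by rewrite -big_seq big_const_seq count_predT iter_addr_0 -[l *+ _]mulr_natl size_takel.
right; rewrite -[leLHS]add0r; apply: lerD => //.
have [y yT yl] : exists2 y, y \in take N S & y < l.
  apply: contrapT => h; apply: small => x xT; rewrite leNgt; apply/negP => xl.
  by apply: h; exists x.
rewrite big_seq [leRHS]big_seq; apply: ler_sum => x xD; rewrite le_min lexx /=.
apply: le_trans (ltW yl).
have : pairwise >=%R S.
  rewrite -(sorted_pairwise (@ge_trans _ R)); exact: (sort_sorted ge_total).
rewrite -[X in pairwise _ X](cat_take_drop N) pairwise_cat => /and3P[/allrelP h _ _].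
exact: h.
Qed.

Lemma limn_esup_ltP (u : nat -> R) l :
  (limn_esup (fun k => (u k)%:E) < l%:E)%E <->
  exists2 c, c < l & exists K, forall k, (K <= k)%N -> u k <= c.
Proof.
split.
  rewrite /limn_esup /limf_esup => /ereal_inf_lt[_ /= [A [K _ KA] <-]] Al.
  have [c cl hc] : exists2 c, c < l & (ereal_sup [set (u k)%:E | k in A] <= c%:E)%E.
    move: Al; case: (ereal_sup _) => [c|//|] h; first by exists c.
    by exists (l - 1); rewrite ?leNye//; lra.
  exists c => //; exists K => k Kk; rewrite -lee_fin; apply: le_trans hc.
  by apply: ereal_sup_ubound; exists k => //; apply: KA.
move=> [c cl [K hK]]; apply: (@le_lt_trans _ _ c%:E); last by rewrite lte_fin.
apply: (@le_trans _ _ (ereal_sup [set (u k)%:E | k in [set k | (K <= k)%N]])).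
  by apply: ereal_inf_lbound; exists [set k | (K <= k)%N] => //; exists K.
by apply: ge_ereal_sup => _ [k /= Kk <-]; rewrite lee_fin hK.
Qed.

Lemma nneseries_pinftyP (u : nat -> R) a : (forall n, (a <= n)%N -> 0 <= u n) ->
  (\sum_(a <= n <oo) (u n)%:E = +oo)%E <->
  forall c, exists2 N, (a <= N)%N & c <= \sum_(a <= n < N) u n.
Proof.
move=> u0; have cv : cvgn (fun n => \sum_(a <= i < n) (u i)%:E)%E.
  by apply: is_cvg_nneseries => n an _; rewrite lee_fin u0.
split=> [uy c|H].
  apply: contrapT => h.
  suff : (\sum_(a <= n <oo) (u n)%:E <= `|c|%:E)%E by rewrite uy.
  apply: lime_le => //; apply: nearW => N; rewrite sumEFin lee_fin.
  have [aN|Na] := leqP a N; last by rewrite big_geq// ltnW.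
  rewrite leNgt; apply/negP => cN; apply: h; exists N => //.
  by rewrite (le_trans (ler_norm _))// ltW.
apply/eqyP => c c0; have [N aN cN] := H c.
apply: (@le_trans _ _ (\sum_(a <= n < N) (u n)%:E)%E); first by rewrite sumEFin lee_fin.
by apply: nneseries_lim_ge => n an _; rewrite lee_fin u0.
Qed.

(** If the truncated series were bounded, it would converge and its terms would tend to 0; from some
    index on the truncation would be inactive, and the original sums would be bounded too. *)
Lemma sum_min_unbounded (a : nat -> R) c : 0 < c -> (forall j, 0 <= a j) ->
  (forall C, exists J, C <= \sum_(0 <= j < J) a j) ->
  forall C, exists J, C <= \sum_(0 <= j < J) Num.min (a j) c.
Proof.
move=> c0 a0 H C; apply: contrapT => h.
pose m j := Num.min (a j) c.
have m0 j : 0 <= m j by rewrite le_min a0 ltW.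
have bnd J : series m J <= C.
  by rewrite leNgt; apply/negP => CJ; apply: h; exists J; apply: ltW.
have cv : cvgn (series m).
  apply: nondecreasing_is_cvgn; first exact: nondecreasing_series.
  by exists C => _ [J _ <-].
have [N _ hN] : \forall j \near \oo, m j < c.
  have := cvg_series_cvg_0 cv => /cvgrPdist_lt /(_ c c0).
  by apply: filterS => j; rewrite sub0r normrN ger0_norm.
have [J] := H (\sum_(0 <= j < N) a j + C + 1).
apply/negP; rewrite -ltNge.
apply: (@le_lt_trans _ _ (\sum_(0 <= j < N) a j + series m J)); last first.
  by have := bnd J; lra.
rewrite /series/=.
have [JN|NJ] := leqP J N.
  apply: (@le_trans _ _ (\sum_(0 <= j < N) a j)).
    by rewrite [leRHS](@big_cat_nat _ _ _ J)//= lerDl sumr_ge0.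
  by rewrite lerDl sumr_ge0.
rewrite (@big_cat_nat _ _ _ N)//=; last exact: ltnW.
rewrite lerD2l [leRHS](@big_cat_nat _ _ _ N)//=; last exact: ltnW.
rewrite -[leLHS]add0r lerD ?sumr_ge0//.
rewrite big_nat [leRHS]big_nat; apply: ler_sum => j /andP[Nj _].
by have := hN j Nj; rewrite /m gt_min ltxx orbF => /ltW/min_idPl ->.
Qed.

End RealLemmas.

(** * Divergence of the weights under (B) *)

Section LogGaps.
Variables (R : realType) (theta : R).
Hypothesis htheta : irrational theta.
Local Notation q := (qn theta).

Definition log_den k : R := ln (q k)%:R.
Definition log_gap k : R := ln ((q k.+1)%:R / (q k)%:R).
Local Notation t := log_den.
Local Notation gap := log_gap.

Lemma qnR_gt0 k : 0 < (q k)%:R :> R.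
Proof. by rewrite ltr0n qn_gt0. Qed.

Lemma qnR_ge1 k : 1 <= (q k)%:R :> R.
Proof. by rewrite ler1n qn_gt0. Qed.

Lemma log_gap_ge0 k : 0 <= gap k.
Proof. by rewrite ln_ge0// ler_pdivlMr ?qnR_gt0// mul1r ler_nat qn_leS. Qed.

Lemma log_den_ge0 k : 0 <= t k.
Proof. by rewrite ln_ge0// qnR_ge1. Qed.

Lemma log_den_homo : {homo t : k l / (k <= l)%N >-> k <= l}.
Proof. by move=> k l kl; rewrite ler_ln ?posrE ?qnR_gt0// ler_nat qn_homo. Qed.

Lemma sum_log_gap a b : (a <= b)%N -> \sum_(a <= i < b) gap i = t b - t a.
Proof. by move=> ab; rewrite -(ln_div_telescope qnR_gt0 ab). Qed.

Lemma sum_log_gap0 k : \sum_(0 <= i < k) gap i = t k.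
Proof. by rewrite sum_log_gap// /t /qn /= ln1 subr0. Qed.

Lemma log_den_unbounded c K : exists2 k, (K <= k)%N & c <= t k.
Proof.
have [k hk] := qn_unbounded htheta (Num.truncn (expR c)).
exists (maxn K k); first exact: leq_maxl.
apply: (@le_trans _ _ (t k)); last by apply: log_den_homo; exact: leq_maxr.
rewrite -(expRK c) ler_ln ?posrE ?expR_gt0 ?qnR_gt0//.
by apply: ltW; apply: lt_le_trans (truncnS_gt _) _; rewrite ler_nat.
Qed.

Lemma log_den_eventually c : exists K, forall k, (K <= k)%N -> c <= t k.
Proof.
have [K _ cK] := log_den_unbounded c 0; exists K => k Kk.
exact: le_trans (log_den_homo Kk).
Qed.

Lemma sum_largest_log_gap k alpha :
  sum_largest [seq ln ((denominator theta i.+1)%:~R / (denominator theta i)%:~R)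
    | i <- iota 0 k] alpha
  = sum_largest [seq gap i | i <- iota 0 k] alpha.
Proof.
by congr sum_largest; apply: eq_map => i; rewrite /gap !qnRE.
Qed.

Lemma sum_map_log_gap k (f : R -> R) :
  \sum_(x <- [seq gap i | i <- iota 0 k]) f x = \sum_(0 <= i < k) f (gap i).
Proof. by rewrite big_map /index_iota subn0. Qed.

(* Either the [N ~ eps t_k / ln t_k] largest gaps are at least [ln t_k / 2], and
   these alone contribute [eps t_k / 4], or all the others are below this bound. *)
Lemma sum_min_gap_ge eps c K : 0 < eps -> c < 1 ->
  (forall k, (K <= k)%N -> (t k)^-1 *
    sum_largest [seq gap i | i <- iota 0 k] (eps * t k / ln (t k)) <= c) ->
  exists eta, [/\ 0 < eta, eta <= 1 & exists K', forall k, (K' <= k)%N ->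
    [/\ 64 <= t k, ln (t k) <= eta / 2 * t k
      & eta * t k <= \sum_(0 <= i < k) Num.min (gap i) (ln (t k / 8))]].
Proof.
(* The value eps / 4 serves the case of many large gaps, and 1 - c the case where the gaps outside
   the largest ones count in full. *)
move=> e0 c1 H; pose eta := Num.min 1 (Num.min (eps / 4) (1 - c)).
have eta0 : 0 < eta by rewrite /eta !lt_min; apply/and3P; split; lra.
have [ee [ec e1]] : eta <= eps / 4 /\ eta <= 1 - c /\ eta <= 1.
  by rewrite /eta !ge_min !lexx !orbT.
exists eta; split => //.
have [x0 x00 hx0] := ln_le_mul (divr_gt0 eta0 (ltr0n _ 2)).
have [K1 hK1] := log_den_eventually 64.
have [K2 hK2] := log_den_eventually x0.
exists (maxn K (maxn K1 K2)) => k; rewrite !geq_max => /and3P[Kk K1k K2k].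
have t64 := hK1 _ K1k; have lnt := hx0 _ (hK2 _ K2k).
split => //.
have t0 : 0 < t k by lra.
(* Since t_k >= 64 = 8^2, passing to t_k / 8 costs at most half of the logarithm. *)
have ln64 : 2 * ln 8 <= ln (t k).
  have <- : ln (64 : R) = 2 * ln 8.
    have -> : 64 = 8 ^+ 2 :> R by rewrite -natrX.
    by rewrite lnXn// mulr_natl.
  by rewrite ler_ln ?posrE.
have ln8 : 0 < ln (8 : R) by rewrite ln_gt0// ltr1n.
have el : ln (t k / 8) = ln (t k) - ln 8 by rewrite ln_div ?posrE.
set l := ln (t k / 8) in el *.
have l2 : ln (t k) / 2 <= l by rewrite el; lra.
have l0 : 0 <= l by lra.
have gap0 : {in [seq gap i | i <- iota 0 k], forall x, 0 <= x}.
  by move=> _ /mapP[i _ ->]; apply: log_gap_ge0.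
have := @sum_min_ge R _ l (eps * t k / ln (t k)) gap0 l0.
rewrite !sum_map_log_gap sum_log_gap0 => -[h|h]; apply: le_trans h.
  have := truncnS_gt (eps * t k / ln (t k)); rewrite -natr1.
  set N := Num.truncn _; rewrite ltr_pdivrMr; last by lra.
  move=> hN; have N0 : 0 <= N%:R :> R by [].
  have : N%:R * (ln (t k) / 2) <= N%:R * l by rewrite ler_wpM2l.
  have : eta * t k <= eps / 4 * t k by rewrite ler_wpM2r// ltW.
  lra.
have := H _ Kk; rewrite ler_pdivrMl// => h.
have : eta * t k <= (1 - c) * t k by rewrite ler_wpM2r// ltW.
lra.
Qed.

(** * Radii of the balls and their sums over blocks *)

Section Weights.
Variable psi : nat -> R.
Hypothesis psi_gt0 : forall n, (0 < n)%N -> 0 < psi n.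
Hypothesis psi_noninc : forall m n, (0 < m)%N -> (m <= n)%N ->
  n%:R * psi n <= m%:R * psi m.

(** This is Psi. The cap makes the inverse of phi = Psi(q_k) at least t_k, so that the truncation
    level ln (1 / (8 phi)) of [weight_block_sum] is at least ln (t_k / 8). *)
Definition capped n : R := Num.min (n%:R * psi n) (1 + ln n%:R)^-1.

Fact block_exists n : exists i, (n < q i.+1)%N.
Proof.
have [i h] := qn_unbounded htheta n; exists i.
exact: leq_trans h (qn_leS htheta i).
Qed.

(** For n > 0 this is the i with q_i <= n < q_(i+1); the first block is empty when q_0 = q_1. *)
Definition block n : nat := ex_minn (block_exists n).

Definition weight n : R := Num.min (capped n / n%:R) (4 * (q (block n).+1)%:R)^-1.

Lemma ln_nat_ge0 n : 0 <= ln (n%:R : R).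
Proof. by case: n => [|n]; [rewrite ln0|rewrite ln_ge0// ler1n]. Qed.

Lemma capped_ge0 n : 0 <= capped n.
Proof.
rewrite le_min invr_ge0 addr_ge0 ?ln_nat_ge0// andbT.
by case: n => [|n]; rewrite ?mul0r// mulr_ge0// ltW// psi_gt0.
Qed.

Lemma capped_gt0 n : (0 < n)%N -> 0 < capped n.
Proof.
move=> n0; rewrite lt_min mulr_gt0 ?ltr0n ?psi_gt0//=.
by rewrite invr_gt0 ltr_pwDl// ln_nat_ge0.
Qed.

Lemma capped_le1 n : capped n <= 1.
Proof.
have p := ln_nat_ge0 n; rewrite ge_min; apply/orP; right.
by rewrite invf_le1; lra.
Qed.

Lemma capped_noninc m n : (0 < m)%N -> (m <= n)%N -> capped n <= capped m.
Proof.
move=> m0 mn; rewrite /capped le_min !ge_min psi_noninc//=.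
have pm := ln_nat_ge0 m; have pn := ln_nat_ge0 n.
rewrite lef_pV2 ?posrE; [|lra|lra].
rewrite lerD2l ler_ln ?posrE ?ltr0n ?ler_nat ?mn ?orbT//.
exact: leq_trans mn.
Qed.

Lemma blockP n i : (q i <= n)%N -> (n < q i.+1)%N -> block n = i.
Proof.
rewrite /block; case: ex_minnP => j nj jmin qin nqi.
apply/eqP; rewrite eqn_leq jmin//= leqNgt; apply/negP => ji.
by have := qn_homo htheta ji; lia.
Qed.

Lemma block_bounds n : (0 < n)%N -> (q (block n) <= n)%N /\ (n < q (block n).+1)%N.
Proof.
rewrite /block; case: ex_minnP => -[|j] nj jmin n0; split => //.
by rewrite leqNgt; apply/negP => /jmin; rewrite ltnn.
Qed.

Lemma block_homo m n : (m <= n)%N -> (block m <= block n)%N.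
Proof.
rewrite /block; case: ex_minnP => i _ imin; case: ex_minnP => j nj _ mn.
by apply: imin; apply: leq_ltn_trans nj.
Qed.

Lemma weight_ge0 n : 0 <= weight n.
Proof. by rewrite le_min divr_ge0 ?capped_ge0//= invr_ge0 mulr_ge0. Qed.

Lemma weight_noninc m n : (0 < m)%N -> (m <= n)%N -> weight n <= weight m.
Proof.
move=> m0 mn; rewrite /weight le_min !ge_min; apply/andP; split; apply/orP.
  left; have n0 : (0 < n)%N by apply: leq_trans mn.
  rewrite ler_pM ?invr_ge0 ?capped_ge0 ?capped_noninc//.
  by rewrite lef_pV2 ?posrE ?ltr0n// ler_nat.
right; rewrite lef_pV2 ?posrE ?mulr_gt0 ?qnR_gt0// ler_pM2l// ler_nat.
by apply: qn_homo => //; rewrite ltnS block_homo.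
Qed.

Lemma weight_separated i n : (q i <= n)%N -> (n < q i.+1)%N ->
  weight n <= (4 * (q i.+1)%:R)^-1.
Proof. by move=> h1 h2; rewrite /weight (blockP h1 h2) ge_min lexx orbT. Qed.

Lemma weight_le1 n : weight n <= 1.
Proof.
rewrite ge_min; apply/orP; right; have := qnR_ge1 (block n).+1 => h.
by rewrite invf_le1; lra.
Qed.

Lemma weight_le_inv n : n%:R * weight n <= 1.
Proof.
case: n => [|n]; first by rewrite mul0r.
apply: (@le_trans _ _ (n.+1%:R * (capped n.+1 / n.+1%:R))).
  by rewrite ler_wpM2l// ge_min lexx.
by rewrite mulrC divfK ?pnatr_eq0// capped_le1.
Qed.

Lemma weight_le_psi n : (0 < n)%N -> weight n <= psi n.
Proof.
move=> n0; rewrite ge_min; apply/orP; left.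
by rewrite ler_pdivrMr ?ltr0n// mulrC ge_min lexx.
Qed.

(* On the block starting at [q i] the bound [1 / (4 q (i+1))] is inactive as soon
   as [4 phi q (i+1) <= n]. *)
Lemma weight_block_sum i phi : 0 < phi -> (forall n, (q i <= n)%N -> (n < q i.+1)%N ->
    phi <= capped n) ->
  phi * Num.min (gap i) (ln (phi^-1 / 8)) <= \sum_(q i <= n < q i.+1) weight n.
Proof.
move=> p0 hphi; set Q := q i.+1.
have Q0 : 0 < Q%:R :> R by apply: qnR_gt0.
(* From [a] on, n >= 4 phi Q, so both terms of the minimum in [weight] are at least phi / n. *)
pose a := maxn (q i) (Num.truncn (4 * phi * Q%:R)).+1.
have sum0 b : 0 <= \sum_(q i <= n < b) weight n.
  by apply: sumr_ge0 => n _; apply: weight_ge0.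
have a0 : (0 < a)%N by rewrite leq_max orbT.
have a0R : 0 < a%:R :> R by rewrite ltr0n.
(* If no n >= a is left, the left side is nonpositive: either 8 phi >= 1, or Q <= q_i, or Q <= 4 phi
   Q + 1 < Q / 2 + 1, which forces Q = 1 and a zero gap. *)
have [Qa|aQ] := leqP Q a.
  have [x1|x1] := leP 1 (8 * phi).
    apply: le_trans (sum0 _); rewrite pmulr_rle0// ge_min; apply/orP; right.
    by rewrite ln_le0// -invfM invf_le1 ?mulr_gt0// mulrC.
  have qa : (Q <= (Num.truncn (4 * phi * Q%:R)).+1)%N \/ (Q <= q i)%N.
    by move: Qa; rewrite leq_max => /orP[]; auto.
  case: qa => qa; last first.
    apply: le_trans (sum0 _); rewrite pmulr_rle0// ge_min; apply/orP; left.
    by rewrite ln_le0// ler_pdivrMr ?qnR_gt0// mul1r ler_nat.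
  have : Q%:R <= 4 * phi * Q%:R + 1.
    apply: le_trans (_ : (Num.truncn (4 * phi * Q%:R))%:R + 1 <= _).
      by rewrite natr1 ler_nat.
    by rewrite lerD2r truncn_le !mulr_ge0 ?ltW.
  have Q1 := qnR_ge1 i.+1; rewrite -/Q in Q1.
  move=> h; have Q2 : Q%:R < 2 :> R.
    have x2 : 0 < 1 - 8 * phi by lra.
    by have := mulr_gt0 x2 Q0; lra.
  have eQ : Q = 1%N by move: Q2; rewrite ltr_nat; have := qn_gt0 htheta i.+1; rewrite -/Q; lia.
  apply: le_trans (sum0 _); rewrite pmulr_rle0// ge_min; apply/orP; left.
  by rewrite ln_le0// -/Q eQ ler_pdivrMr ?qnR_gt0// mul1r qnR_ge1.
have qia : (q i <= a)%N by rewrite leq_maxl.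
rewrite (@big_cat_nat _ _ _ a)//=; last exact: ltnW.
apply: (@le_trans _ _ (\sum_(a <= n < Q) weight n)); last by rewrite lerDr.
apply: (@le_trans _ _ (\sum_(a <= n < Q) phi * n%:R^-1)).
  rewrite -mulr_sumr ler_wpM2l ?(ltW p0)//.
  apply: le_trans (harmonic_ge R a0 (ltnW aQ)).
  (* If 4 phi Q >= 1, then a <= 4 phi Q + 1 <= 8 phi Q and Q / a >= 1 / (8 phi); otherwise a = q_i
     and ln (Q / a) is the gap. *)
  rewrite ge_min /a /gap -/Q; case: (leqP (q i) (Num.truncn (4 * phi * Q%:R)).+1) => [h|h].
    have [x1|x1] := leP 1 (4 * phi * Q%:R).
      apply/orP; right; rewrite ler_ln ?posrE ?divr_gt0 ?invr_gt0//.
      have : (Num.truncn (4 * phi * Q%:R))%:R <= 4 * phi * Q%:R.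
        by rewrite truncn_le !mulr_ge0 ?ltW.
      rewrite -natr1 ler_pdivlMr; last by rewrite natr1.
      move=> h2; rewrite mulrAC ler_pdivrMr// -ler_pdivlMl ?invr_gt0// invrK; lra.
    apply/orP; left; rewrite ler_ln ?posrE ?divr_gt0 ?qnR_gt0//.
    rewrite ler_pM2l// lef_pV2 ?posrE ?qnR_gt0// ler_nat.
    suff -> : Num.truncn (4 * phi * Q%:R) = 0%N by apply: qn_gt0.
    by apply/eqP; rewrite -leqn0 truncn_le_nat.
  by apply/orP; left.
rewrite big_nat [leRHS]big_nat; apply: ler_sum => n /andP[an nQ].
have qin : (q i <= n)%N by apply: leq_trans an.
have n0 : (0 < n)%N by apply: leq_trans an.
have n0R : 0 < n%:R :> R by rewrite ltr0n.
rewrite /weight (blockP qin nQ) -/Q le_min; apply/andP; split.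
  by rewrite ler_pM2r ?invr_gt0// hphi.
have : 4 * phi * Q%:R <= n%:R.
  apply: ltW; apply: lt_le_trans (truncnS_gt _) _; rewrite ler_nat.
  by apply: leq_trans an; rewrite leq_maxr.
move=> h; rewrite -[(4 * _)^-1]mul1r ler_pdivlMr ?mulr_gt0// mulrAC ler_pdivrMr//.
by lra.
Qed.

Variables (eta : R) (K : nat).
Hypotheses (eta_gt0 : 0 < eta) (eta_le1 : eta <= 1).
Hypothesis gaps : forall k, (K <= k)%N ->
    [/\ 64 <= t k, ln (t k) <= eta / 2 * t k
      & eta * t k <= \sum_(0 <= i < k) Num.min (gap i) (ln (t k / 8))].

(** The truncated gaps below k add up to at least eta t_k, and those below i0 to at most t_(i0), so
    at least half of this bound remains. As Psi is nonincreasing, [weight_block_sum] applies to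
    every block with phi = Psi(q_k). *)
Lemma weight_chunk_sum i0 k : (i0 <= k)%N -> (K <= k)%N -> t i0 <= eta / 2 * t k ->
  capped (q k) * (eta / 2 * t k) <= \sum_(q i0 <= n < q k) weight n.
Proof.
move=> i0k Kk ti0; have [t64 _ hk] := gaps Kk.
have p0 := capped_gt0 (qn_gt0 htheta k); set phi := capped (q k) in p0 *.
have tphi : t k <= phi^-1.
  rewrite -[leLHS]invrK lef_pV2 ?posrE ?invr_gt0//; last by lra.
  rewrite /phi /capped ge_min; apply/orP; right.
  by rewrite lef_pV2 ?posrE -/(t k); lra.
rewrite sum_qn_blocks//.
apply: (@le_trans _ _ (\sum_(i0 <= i < k) phi * Num.min (gap i) (ln (phi^-1 / 8)))).
  rewrite -mulr_sumr ler_wpM2l ?(ltW p0)//.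
  apply: (@le_trans _ _ (\sum_(i0 <= i < k) Num.min (gap i) (ln (t k / 8)))).
    have : \sum_(0 <= i < i0) Num.min (gap i) (ln (t k / 8)) <= t i0.
      by rewrite -(sum_log_gap0 i0); apply: ler_sum => i _; rewrite ge_min lexx.
    move: hk; rewrite (@big_cat_nat _ _ _ i0)//=; lra.
  apply: ler_sum => i _; rewrite le_min !ge_min lexx /=; apply/orP; right.
  by rewrite ler_ln ?posrE ?divr_gt0 ?invr_gt0//; lra.
rewrite big_nat [leRHS]big_nat; apply: ler_sum => i /andP[_ ik].
apply: weight_block_sum => // n qn1 qn2; apply: capped_noninc.
  exact: leq_trans (qn_gt0 htheta i) qn1.
by apply: leq_trans (ltnW qn2) _; apply: qn_homo.
Qed.

(** The last truncated gap is at most ln t_(k+1) <= (eta / 2) t_(k+1) and the earlier ones add up to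
    at most t_k, while the total is at least eta t_(k+1). *)
Lemma log_den_ratio k : (K <= k)%N -> t k.+1 <= 2 / eta * t k.
Proof.
move=> Kk; have [t64 lnt] := gaps (leqW Kk).
have : \sum_(0 <= i < k.+1) Num.min (gap i) (ln (t k.+1 / 8)) <= t k + ln (t k.+1).
  rewrite big_nat_recr//=; apply: lerD.
    by rewrite -(sum_log_gap0 k); apply: ler_sum => i _; rewrite ge_min lexx.
  rewrite ge_min; apply/orP; right; rewrite ler_ln ?posrE; lra.
move=> h1 h2; rewrite mulrAC ler_pdivlMr//; lra.
Qed.

Fact next_exists k : exists m, 2 / eta * t k <= t m.
Proof. by have [m _ h] := log_den_unbounded (2 / eta * t k) 0; exists m. Qed.

Definition next k : nat := ex_minn (next_exists k).

Lemma next_gt k : (K <= k)%N -> (k < next k)%N.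
Proof.
move=> Kk; rewrite /next; case: ex_minnP => m hm _; rewrite ltnNge; apply/negP => mk.
have := log_den_homo mk; have [t64 _ _] := gaps Kk.
have : 2 * t k <= 2 / eta * t k.
  rewrite ler_wpM2r ?log_den_ge0// ler_pdivlMr// -[leRHS]mulr1.
  by rewrite ler_pM2l.
lra.
Qed.

Lemma next_ge k : t k <= eta / 2 * t (next k).
Proof.
rewrite /next; case: ex_minnP => m; rewrite mulrAC ler_pdivrMr//; lra.
Qed.

(** By minimality the index before [next k] has not reached the factor 2 / eta, and [log_den_ratio]
    allows one more such factor. Iterating [next] thus cuts t into stretches of comparable geometric
    length. *)
Lemma next_le k : (K <= k)%N -> t (next k) <= (2 / eta) ^+ 2 * t k.
Proof.
move=> Kk; have := next_gt Kk; rewrite /next; case: ex_minnP => -[//|m] hm mmin km.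
have tm : t m <= 2 / eta * t k.
  by apply: ltW; rewrite ltNge; apply/negP => /mmin; rewrite ltnn.
apply: le_trans (log_den_ratio _) _; first by lia.
by rewrite expr2 -[leRHS]mulrA ler_wpM2l// divr_ge0// ltW.
Qed.

Hypothesis psi_sum : (\sum_(1 <= n <oo) (psi n)%:E = +oo)%E.

Lemma weight_sum_unbounded l0 :
  exists2 l1, (l0 <= l1)%N & 1 <= \sum_(q l0 <= n < q l1) weight n.
Proof.
pose kk j := iter j next (maxn K l0).
have kk0 : kk 0%N = maxn K l0 by [].
have kkE j : kk j.+1 = next (kk j) by [].
clearbody kk.
have Kk j : (K <= kk j)%N.
  elim: j => [|j IH]; first by rewrite kk0 leq_maxl.
  by rewrite kkE; apply: leq_trans (ltnW (next_gt IH)).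
have kkS j : (kk j < kk j.+1)%N by rewrite kkE; apply: next_gt.
have kkhomo : {homo kk : i j / (i <= j)%N}.
  by apply: homo_leq => [//|? ? ?|j]; [apply: leq_trans|apply: ltnW].
have kk_ge j : (j <= kk j)%N.
  by elim: j => // j IH; apply: leq_ltn_trans (kkS j).
have t64 j : 64 <= t (kk j) by have [] := gaps (Kk j).
pose Psi j := (q (kk j))%:R * psi (q (kk j)).
pose A := (2 / eta) ^+ 2.
have A0 : 0 < A by rewrite exprn_gt0// divr_gt0.
have Psi0 j : 0 <= Psi j by rewrite mulr_ge0// ltW// psi_gt0// qn_gt0.
(* On the stretch psi(n) <= [Psi j] / n, and the harmonic sum is at most 2 t at its right end; hence
   divergence of the sum of psi carries over to the terms [Psi j * t (kk j)]. *)
have psi_chunk j : \sum_(q (kk j) <= n < q (kk j.+1)) psi n <= 2 * A * (Psi j * t (kk j)).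
  apply: (@le_trans _ _ (\sum_(q (kk j) <= n < q (kk j.+1)) Psi j * n%:R^-1)).
    rewrite big_nat [leRHS]big_nat; apply: ler_sum => n /andP[qn1 _].
    have n0 : (0 < n)%N by apply: leq_trans qn1; apply: qn_gt0.
    rewrite ler_pdivlMr ?ltr0n// mulrC; apply: psi_noninc => //; exact: qn_gt0.
  rewrite -mulr_sumr.
  have -> : 2 * A * (Psi j * t (kk j)) = Psi j * (2 * (A * t (kk j))) by ring.
  rewrite ler_wpM2l//; apply: le_trans (harmonic_le _ _ _) _; first exact: qn_gt0.
    exact: qn_homo (ltnW (kkS j)).
  rewrite ler_pM2l//; apply: (@le_trans _ _ (t (kk j.+1))); last first.
    by rewrite kkE; apply: next_le; exact: Kk.
  rewrite ler_ln ?posrE ?divr_gt0 ?qnR_gt0// ler_pdivrMr ?qnR_gt0//.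
  by rewrite ler_peMr// qnR_ge1.
have blocks_kk (f : nat -> R) J : \sum_(q (kk 0%N) <= n < q (kk J)) f n =
    \sum_(0 <= j < J) \sum_(q (kk j) <= n < q (kk j.+1)) f n.
  elim: J => [|J IH]; first by rewrite !big_geq.
  rewrite big_nat_recr//= -IH -big_cat_nat//=.
    by apply: (qn_homo htheta); apply: kkhomo.
  by apply: (qn_homo htheta); apply: kkhomo.
have unb C : exists J, C <= \sum_(0 <= j < J) Psi j * t (kk j).
  have psi0 n : (1 <= n)%N -> 0 <= psi n by move=> n0; rewrite ltW// psi_gt0.
  have [/(_ psi_sum) H _] := nneseries_pinftyP psi0.
  have [N N1 hN] := H (\sum_(1 <= n < q (kk 0)) psi n + 2 * A * C).
  have [i iN] := qn_unbounded htheta N.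
  pose J := i.
  have NJ : (N <= q (kk J))%N.
    by apply: leq_trans (ltnW iN) _; apply: qn_homo => //; apply: kk_ge.
  exists J; rewrite -(ler_pM2l (mulr_gt0 (ltr0n _ 2) A0)) mulr_sumr.
  apply: (@le_trans _ _ (\sum_(q (kk 0) <= n < q (kk J)) psi n)).
    have : \sum_(1 <= n < N) psi n <= \sum_(1 <= n < q (kk J)) psi n.
      rewrite [leRHS](@big_cat_nat _ _ _ N)//= lerDl big_nat sumr_ge0// => n /andP[Nn _].
      by apply: psi0; lia.
    rewrite [leRHS](@big_cat_nat _ _ _ (q (kk 0)))//=;
      last by apply: (qn_homo htheta); apply: kkhomo.
      lra.
    exact: qn_gt0.
  rewrite blocks_kk.
  by apply: ler_sum => j _; apply: psi_chunk.
have a0 j : 0 <= Psi j * t (kk j) by rewrite mulr_ge0// log_den_ge0.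
(* The extra 1 absorbs the first term, lost in the shift from j to j + 1; the remaining 4 / eta
   cancels the factor eta / 4 of [chunk]. *)
have [J hJ] := sum_min_unbounded (ltr0n R 1 : 0 < 1) a0 unb (4 / eta + 1).
exists (kk J).
  by apply: leq_trans (leq_maxr K l0) _; rewrite -kk0; apply: kkhomo.
have chunk j : eta / 4 * Num.min (Psi j.+1 * t (kk j.+1)) 1 <=
    \sum_(q (kk j) <= n < q (kk j.+1)) weight n.
  have := @weight_chunk_sum (kk j) (kk j.+1) (ltnW (kkS j)) (Kk _) _.
  move=> /(_ ltac:(by rewrite kkE; apply: next_ge)); apply: le_trans.
  have t1 := t64 j.+1; set T := t (kk j.+1) in t1 *.
  have T0 : 0 <= T by lra.
  set m := Num.min _ _; suff h : m / 2 <= capped (q (kk j.+1)) * T.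
    have -> : eta / 4 * m = eta / 2 * (m / 2) by field.
    by rewrite [leRHS]mulrCA ler_wpM2l// divr_ge0// ltW.
  have m0 : 0 <= m by rewrite le_min a0 ler01.
  (* The first term of the minimum gives Psi T; the cap gives T / (1 + T) >= 1/2. *)
  rewrite /capped -/(t _) -/(Psi _) -/T [leRHS]minr_pMl// le_min; apply/andP; split.
    by apply: (@le_trans _ _ m); [lra|rewrite ge_min lexx].
  apply: (@le_trans _ _ (1 / 2)); first by rewrite ler_pM2r// ge_min lexx orbT.
  by rewrite [leRHS]mulrC ler_pdivlMr; lra.
apply: (@le_trans _ _ (\sum_(q (kk 0%N) <= n < q (kk J)) weight n)); last first.
  have lk : (l0 <= kk 0)%N by rewrite kk0 leq_maxr.
  rewrite [leRHS](@big_cat_nat _ _ _ (q (kk 0%N)))//=.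
  - by rewrite lerDr sumr_ge0// => n _; apply: weight_ge0.
  - exact: qn_homo.
  - by apply: (qn_homo htheta); apply: kkhomo.
rewrite blocks_kk; apply: (@le_trans _ _
    (\sum_(0 <= j < J) eta / 4 * Num.min (Psi j.+1 * t (kk j.+1)) 1)); last first.
  by apply: ler_sum => j _; apply: chunk.
rewrite -mulr_sumr.
pose m j := Num.min (Psi j * t (kk j)) 1.
have m1 j : 0 <= m j <= 1 by rewrite le_min a0 ler01 ge_min lexx orbT.
have : \sum_(0 <= j < J) m j <= m 0%N + \sum_(0 <= j < J) m j.+1.
  rewrite -(big_nat_recl J 0%N m)// big_nat_recr//= lerDl.
  by have /andP[] := m1 J.
have /andP[_ m01] := m1 0%N.
move=> h; rewrite -[X in _ <= _ * X]/(\sum_(0 <= j < J) m j.+1) mulrAC ler_pdivlMr// mul1r.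
have hJ' : 4 / eta + 1 <= \sum_(0 <= j < J) m j := hJ.
have : 4 / eta <= \sum_(0 <= j < J) m j.+1 by move: (4 / eta) hJ' => e; lra.
by rewrite ler_pdivrMr// mulrC.
Qed.

End Weights.
End LogGaps.

(** * Coverings of the points approximated within a block *)

Section ConvergencePart.
Variables (R : realType) (theta : R).
Hypothesis htheta : irrational theta.
Local Notation mu := (@lebesgue_measure R).
Local Notation q := (qn theta).
Local Notation x := (frac_multiple theta).
Local Notation t := (log_den theta).
Local Notation gap := (log_gap theta).

Lemma measure_bigsetU_le (s : seq nat) (F : nat -> set R) (f : nat -> R) :
  (forall n, measurable (F n)) -> (forall n, (mu (F n) <= (f n)%:E)%E) ->
  measurable (\big[setU/set0]_(n <- s) F n) /\
  (mu (\big[setU/set0]_(n <- s) F n) <= (\sum_(n <- s) f n)%:E)%E.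
Proof.
move=> mF Ff; elim: s => [|n s [mS muS]]; first by rewrite !big_nil measure0.
rewrite !big_cons EFinD; split; first by apply: measurableU.
apply: (@le_trans _ _ (mu (F n) + mu (\big[setU/set0]_(n <- s) F n))%E).
  by apply: measureU2; [exact: mF|exact: mS].
by apply: leeD.
Qed.

Lemma bigsetU_index (a b n : nat) (F : nat -> set R) s : (a <= n)%N -> (n < b)%N ->
  F n s -> (\big[setU/set0]_(a <= i < b) F i) s.
Proof.
move=> an nb Fs; rewrite -bigcup_seq; exists n => //=.
by rewrite mem_index_iota an.
Qed.

(* The part of the [r]-neighbourhood of [y + Z] that can meet [m, m + 1). *)
Definition near_translates (m : int) (y r : R) : set R :=
  ball (y + m%:~R - 1) r `|` (ball (y + m%:~R) r `|` ball (y + m%:~R + 1) r).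

Lemma measurable_near_translates m y r : measurable (near_translates m y r).
Proof.
apply: measurableU; first exact: measurable_ball.
by apply: measurableU; exact: measurable_ball.
Qed.

Lemma measure_near_translates m y r : 0 <= r ->
  (mu (near_translates m y r) <= (6 * r)%:E)%E.
Proof.
move=> r0; have mb z : measurable (ball z r : set R) by apply: measurable_ball.
have -> : (6 * r)%:E = (mu (ball (y + m%:~R - 1)%R r) +
    (mu (ball (y + m%:~R)%R r) + mu (ball (y + m%:~R + 1)%R r)))%E.
  by rewrite !lebesgue_measure_ball// -!EFinD; congr (_%:E); ring.
have h2 : (mu (ball (y + m%:~R)%R r `|` ball (y + m%:~R + 1)%R r) <=
  mu (ball (y + m%:~R)%R r) + mu (ball (y + m%:~R + 1)%R r))%E.
  by apply: measureU2; exact: mb.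
apply: le_trans (leeD2l _ h2).
by apply: measureU2; [exact: mb|apply: measurableU; exact: mb].
Qed.

(** The bounds on y, s and r place the integer - p - m strictly between -2 and 2, which leaves three
    translates. *)
Lemma near_translatesP m y s (p : int) (r : R) : 0 <= y < 1 -> m%:~R <= s < m%:~R + 1 ->
  r <= 1 -> `|y - s - p%:~R| < r -> near_translates m y r s.
Proof.
move=> /andP[y0 y1] /andP[s0 s1] r1 h.
have [lo hi] : -2 < (- p - m)%:~R :> R /\ (- p - m)%:~R < 2 :> R.
  move: (lt_le_trans h r1); rewrite ltr_norml intrB mulrNz => /andP[? ?]; split; lra.
have [lo' hi'] : -2 < - p - m /\ - p - m < 2.
  by move: lo hi; rewrite -[2]/(2%:~R) -mulrNz !ltr_int.
have [e|[e|e]] : p = - m + 1 \/ p = - m \/ p = - m - 1 by lia.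
- by left; rewrite /ball/=; move: h; rewrite e intrD mulrNz; congr (`|_| < _); ring.
- by right; left; rewrite /ball/=; move: h; rewrite e mulrNz; congr (`|_| < _); ring.
- by right; right; rewrite /ball/=; move: h; rewrite e intrB mulrNz; congr (`|_| < _); ring.
Qed.

Lemma frac_multiple_shift n s (p : int) (r : R) : `|n%:R * theta - s - p%:~R| < r ->
  exists p', `|x n - s - p'%:~R| < r.
Proof.
exists (p - Num.floor (n%:R * theta)); rewrite /frac_multiple intrB.
by move: H; congr (`|_| < _); ring.
Qed.

Definition block_hits (psi : nat -> R) (m : int) (a b : nat) : set R :=
  [set s | m%:~R <= s < m%:~R + 1 /\ exists n, [/\ (a <= n)%N, (n < b)%N &
    exists p : int, `|n%:R * theta - s - p%:~R| < psi n]].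

(** Each n gets its own three balls, of total measure 6 / (n T), and the harmonic sum over the block
    is at most twice the gap. *)
Lemma block_cover_all m i T : 2 <= T -> exists F, [/\ measurable F,
  block_hits (fun n => (n%:R * T)^-1) m (q i) (q i.+1) `<=` F
  & (mu F <= (12 / T * gap i)%:E)%E].
Proof.
move=> T2; have T0 : 0 < T by lra.
pose psi n : R := (n%:R * T)^-1.
have psi0 n : 0 <= psi n by rewrite invr_ge0 mulr_ge0// ltW.
have [mF hF] := measure_bigsetU_le (index_iota (q i) (q i.+1))
  (fun n => measurable_near_translates m (x n) (psi n))
  (fun n => measure_near_translates m (x n) (psi0 n)).
eexists; split; [exact: mF| |apply: le_trans hF _].
- move=> s [ms [n [qn1 qn2 [p hp]]]]; apply: (bigsetU_index qn1 qn2).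
  have [p' hp'] := frac_multiple_shift hp.
  apply: near_translatesP hp' => //; first exact: frac_multiple_itv.
  have n1 : 1 <= n%:R :> R by rewrite ler1n (leq_trans (qn_gt0 htheta i)).
  by rewrite invf_le1 ?mulr_gt0//; nra.
rewrite lee_fin; have -> : \sum_(q i <= n < q i.+1) 6 * psi n =
    6 / T * \sum_(q i <= n < q i.+1) n%:R^-1.
  by rewrite mulr_sumr; apply: eq_bigr => n _; rewrite /psi invfM; ring.
have -> : 12 / T * gap i = 6 / T * (2 * gap i) by ring.
rewrite ler_wpM2l ?divr_ge0 ?(ltW T0)// harmonic_le ?qn_gt0// qn_leS//.
Qed.

(* The points [n theta] with [n <= q (i+1) / T] are close to those with [n < q i]. *)
Lemma block_cover_clusters m i T : expR 1 <= T -> exists F, [/\ measurable F,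
  block_hits (fun n => (n%:R * T)^-1) m (q i) (q i.+1) `<=` F
  & (mu F <= (24 / T * ln T)%:E)%E].
Proof.
move=> Te; have T2 : 2 <= T by have := @expR_ge1Dx R 1; lra.
have T0 : 0 < T by lra.
have lnT1 : 1 <= ln T by rewrite -[leLHS]expRK ler_ln ?posrE ?expR_gt0.
pose psi n : R := (n%:R * T)^-1.
have psi0 n : 0 <= psi n by rewrite invr_ge0 mulr_ge0// ltW.
set Q := q i.+1; pose a := (Num.truncn (Q%:R / T)).+1.
have Q0 : 0 < Q%:R :> R by apply: qnR_gt0.
have q0 : 0 < (q i)%:R :> R by apply: qnR_gt0.
have QT0 : 0 <= Q%:R / T by rewrite divr_ge0// ltW.
have aQT : Q%:R / T < a%:R by apply: truncnS_gt.
have aQ : (a <= Q)%N.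
  rewrite /a truncn_lt_nat// ltr_pdivrMr// ltr_pMr//; lra.
(* Half of [rho] bounds psi(n) for n >= q_i. The other half bounds the displacement j / Q incurred
   when n = j q_i + r is replaced by r, since j q_i <= n <= Q / T. *)
pose rho : R := 2 / ((q i)%:R * T).
have rho0 : 0 <= rho by rewrite divr_ge0// mulr_ge0// ltW.
have [mF hF] := measure_bigsetU_le (index_iota a Q)
  (fun n => measurable_near_translates m (x n) (psi n))
  (fun n => measure_near_translates m (x n) (psi0 n)).
have [mF' hF'] := measure_bigsetU_le (index_iota 0 (q i))
  (fun n => measurable_near_translates m (x n) rho)
  (fun n => measure_near_translates m (x n) rho0).
eexists; split; [exact: (measurableU _ _ mF mF')| |].
- move=> s [ms [n [qn1 qn2 [p hp]]]].
  have n1 : 1 <= n%:R :> R by rewrite ler1n (leq_trans (qn_gt0 htheta i)).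
  have [an|na] := leqP a n.
    left; apply: (bigsetU_index an qn2).
    have [p' hp'] := frac_multiple_shift hp.
    apply: near_translatesP hp' => //; first exact: frac_multiple_itv.
    by rewrite invf_le1 ?mulr_gt0//; nra.
  right; pose r := (n %% q i)%N; pose j := (n %/ q i)%N.
  have rq : (r < q i)%N by rewrite ltn_mod qn_gt0.
  apply: (bigsetU_index (leq0n r) rq).
  have en : n = (j * q i + r)%N by apply: divn_eq.
  have nQ : n%:R <= Q%:R / T.
    by apply: le_trans (_ : (Num.truncn (Q%:R / T))%:R <= _); rewrite ?truncn_le// ler_nat.
  have jle : j%:R * (q i)%:R <= n%:R :> R by rewrite -natrM ler_nat en leq_addr.
  have close : `|r%:R * theta - s - (p - j%:Z * numerator theta i)%:~R| < rho.
    have -> : r%:R * theta - s - (p - j%:Z * numerator theta i)%:~R =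
       (n%:R * theta - s - p%:~R) - j%:R * convergent_error theta i.
      rewrite en /convergent_error natrD natrM intrB intrM -(pmulrn _ j); ring.
    apply: le_lt_trans (ler_normB _ _) _.
    have -> : rho = ((q i)%:R * T)^-1 + ((q i)%:R * T)^-1 by rewrite /rho; ring.
    apply: ltr_leD.
      apply: lt_le_trans hp _; rewrite lef_pV2 ?posrE ?mulr_gt0//; last by lra.
      by rewrite ler_pM2r// ler_nat.
    rewrite normrM ger0_norm//.
    apply: (@le_trans _ _ (j%:R * Q%:R^-1)).
      by rewrite ler_wpM2l// convergent_error_le.
    rewrite ler_pdivrMr// invfM mulrAC -[leRHS]mulrA ler_pdivlMl//.
    by apply: le_trans nQ; rewrite mulrC.
  have [p' hp'] := frac_multiple_shift close.
  apply: near_translatesP hp' => //; first exact: frac_multiple_itv.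
  rewrite ler_pdivrMr ?mulr_gt0// mul1r; have := qnR_ge1 htheta i; nra.
apply: (@le_trans _ _ ((\sum_(a <= n < Q) 6 * psi n)%:E +
    (\sum_(0 <= n < q i) 6 * rho)%:E)%E).
  by apply: le_trans (leeD hF hF'); apply: measureU2.
rewrite -EFinD lee_fin.
have -> : \sum_(0 <= n < q i) 6 * rho = 12 / T.
  by rewrite sumr_const_nat subn0 -mulr_natl /rho; field; rewrite !gt_eqF.
have -> : \sum_(a <= n < Q) 6 * psi n = 6 / T * \sum_(a <= n < Q) n%:R^-1.
  by rewrite mulr_sumr; apply: eq_bigr => n _; rewrite /psi invfM; ring.
(* As Q / a <= T, the indices from [a] on cost at most 12 ln T / T; the clusters cost 12 / T, which
   is no more because ln T >= 1. *)
have h : \sum_(a <= n < Q) n%:R^-1 <= 2 * ln T.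
  apply: le_trans (harmonic_le R (ltn0Sn _) aQ) _.
  rewrite ler_pM2l// ler_ln ?posrE ?divr_gt0// ?ltr0n//.
  by rewrite ler_pdivrMr ?ltr0n// mulrC -ler_pdivrMr// ltW.
have iT : 0 < T^-1 by rewrite invr_gt0.
have h1 : T^-1 * \sum_(a <= n < Q) n%:R^-1 <= T^-1 * (2 * ln T) by rewrite ler_pM2l.
have h2 : T^-1 * 1 <= T^-1 * ln T by rewrite ler_pM2l.
lra.
Qed.

Lemma block_cover m i T : expR 1 <= T -> exists F, [/\ measurable F,
  block_hits (fun n => (n%:R * T)^-1) m (q i) (q i.+1) `<=` F
  & (mu F <= (24 / T * Num.min (gap i) (ln T))%:E)%E].
Proof.
move=> Te; have T2 : 2 <= T by have := @expR_ge1Dx R 1; lra.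
have [gT|Tg] := leP (gap i) (ln T); last exact: block_cover_clusters.
have [F [mF sF hF]] := block_cover_all m i T2; exists F; split => //.
apply: le_trans hF _; rewrite lee_fin ler_wpM2r ?log_gap_ge0//.
by rewrite ler_wpM2r ?invr_ge0; lra.
Qed.

(** In [sum_min_le] at level ln T, the at most eps T / ln T largest gaps contribute at most eps T,
    and by concentration the others do too. Multiplying 2 eps T by the factor 24 / T of
    [block_cover] gives 48 eps. *)
Lemma chunk_cover m a b T eps : (a <= b)%N -> expR 1 <= T -> t b = T -> 0 <= eps ->
  1 - eps < T^-1 * sum_largest [seq gap i | i <- iota 0 b] (eps * T / ln T) ->
  exists G, [/\ measurable G,
    block_hits (fun n => (n%:R * T)^-1) m (q a) (q b) `<=` G
    & (mu G <= (48 * eps)%:E)%E].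
Proof.
move=> ab Te tb e0 hs; have T2 : 2 <= T by have := @expR_ge1Dx R 1; lra.
have T0 : 0 < T by lra.
have lnT1 : 1 <= ln T by rewrite -[leLHS]expRK ler_ln ?posrE ?expR_gt0.
have [F hF] := choice (fun i => block_cover m i Te).
have mF i : measurable (F i) by have [] := hF i.
have muF i : (mu (F i) <= (24 / T * Num.min (gap i) (ln T))%:E)%E by have [] := hF i.
have [mG hG] := measure_bigsetU_le (index_iota a b) mF muF.
eexists; split; [exact: mG| |apply: le_trans hG _].
  move=> s [ms [n [qan nqb [p hp]]]].
  have n0 : (0 < n)%N by apply: leq_trans (qn_gt0 htheta a) qan.
  have [i [ai ib qi qi1]] : exists i, [/\ (a <= i)%N, (i < b)%N, (q i <= n)%N & (n < q i.+1)%N].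
    exists (block htheta n); have [h1 h2] := block_bounds htheta n0; split => //.
      rewrite leqNgt; apply/negP => ba; have := qn_homo htheta ba; lia.
    rewrite ltnNge; apply/negP => ba; have := qn_homo htheta ba; lia.
  apply: (bigsetU_index ai ib); have [_ sF _] := hF i; apply: sF.
  by split => //; exists n; split => //; exists p.
rewrite lee_fin -mulr_sumr.
have l0 : 0 <= ln T by lra.
have := @sum_min_le R [seq gap i | i <- iota 0 b] (ln T) (eps * T / ln T) l0.
rewrite !sum_map_log_gap sum_log_gap0// tb => h.
have h0 : \sum_(a <= i < b) Num.min (gap i) (ln T) <= \sum_(0 <= i < b) Num.min (gap i) (ln T).
  rewrite [leRHS](@big_cat_nat _ _ _ a)//= lerDr sumr_ge0// => i _.
  by rewrite le_min log_gap_ge0.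
have h1 : (Num.truncn (eps * T / ln T))%:R * ln T <= eps * T.
  by rewrite -ler_pdivlMr ?truncn_le ?divr_ge0 ?mulr_ge0//; lra.
move: hs; rewrite mulrC ltr_pdivlMr// => hs.
have -> : 48 * eps = 24 / T * (2 * eps * T) by field; rewrite gt_eqF.
rewrite ler_wpM2l ?divr_ge0 ?(ltW T0)//; lra.
Qed.

End ConvergencePart.

(** * A Khinchin sequence with null set W when (B) fails *)

Section Counterexample.
Variables (R : realType) (theta : R).
Hypothesis htheta : irrational theta.
Local Notation mu := (@lebesgue_measure R).
Local Notation q := (qn theta).
Local Notation t := (log_den theta).
Local Notation gap := (log_gap theta).
Hypothesis concentrated : forall eps c K, 0 < eps -> c < 1 -> exists2 k, (K <= k)%N &
  c < (t k)^-1 * sum_largest [seq gap i | i <- iota 0 k] (eps * t k / ln (t k)).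

Let tol j : R := (2 ^+ j.+1)^-1.

Let tol_gt0 j : 0 < tol j.
Proof. by rewrite invr_gt0 exprn_gt0. Qed.

(** The doubling of t will make the sum of psi diverge, and concentration with the summable
    tolerances [tol] will make the coverings summable. The recursion carries the pair (j, k),
    because the tolerance depends on j. *)
Lemma concentrated_sequence : exists kk : nat -> nat, [/\ expR 1 <= t (kk 0%N),
  forall j, (kk j < kk j.+1)%N, forall j, 2 * t (kk j) <= t (kk j.+1) &
  forall j, let T := t (kk j.+1) in
    1 - tol j < T^-1 * sum_largest [seq gap i | i <- iota 0 (kk j.+1)] (tol j * T / ln T)].
Proof.
have step (jk : nat * nat) : exists m, [/\ (jk.2 < m)%N, 2 * t jk.2 <= t m &
    1 - tol jk.1 < (t m)^-1 *
      sum_largest [seq gap i | i <- iota 0 m] (tol jk.1 * t m / ln (t m))].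
  case: jk => j k /=; have [K hK] := log_den_eventually htheta (2 * t k).
  have c1 : 1 - tol j < 1 by rewrite ltrBlDr ltrDl.
  have [m Km hm] := concentrated (maxn K k.+1) (tol_gt0 j) c1.
  move: Km; rewrite geq_max => /andP[Km km]; exists m; split => //.
  exact: hK.
have [g hg] := choice step.
have [k0 _ hk0] := log_den_unbounded htheta (expR 1) 0.
pose kk := fix kk j := if j is i.+1 then g (i, kk i) else k0.
by exists kk; split => // j; have [] := hg (j, kk j).
Qed.

Section Psi.
Variable kk : nat -> nat.
Hypothesis kk0 : expR 1 <= t (kk 0%N).
Hypothesis kkS : forall j, (kk j < kk j.+1)%N.
Hypothesis t2 : forall j, 2 * t (kk j) <= t (kk j.+1).
Hypothesis conc : forall j, let T := t (kk j.+1) in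
    1 - tol j < T^-1 * sum_largest [seq gap i | i <- iota 0 (kk j.+1)] (tol j * T / ln T).

Let kk_homo : {homo kk : i j / (i <= j)%N}.
Proof. by apply: homo_leq => [//|? ? ?|j]; [apply: leq_trans|apply: ltnW]. Qed.

Let kk_ge j : (j <= kk j)%N.
Proof. by elim: j => // j IH; apply: leq_ltn_trans (kkS j). Qed.

Fact chunk_exists n : exists j, (n < q (kk j))%N.
Proof.
have [j h] := qn_unbounded htheta n; exists j.
by apply: leq_trans h _; apply: qn_homo => //; apply: kk_ge.
Qed.

Definition chunk n : nat := ex_minn (chunk_exists n).

(** The product n psi(n) is constant on each stretch, equal to 1 / t at its right end. *)
Definition step_psi n : R := (n%:R * t (kk (chunk n)))^-1.

Let te j : expR 1 <= t (kk j).
Proof. by apply: le_trans kk0 _; apply: log_den_homo => //; apply: kk_homo. Qed.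

Let t_gt0 j : 0 < t (kk j).
Proof. exact: lt_le_trans (expR_gt0 1) (te j). Qed.

Lemma chunk_homo m n : (m <= n)%N -> (chunk m <= chunk n)%N.
Proof.
rewrite /chunk; case: ex_minnP => i _ imin; case: ex_minnP => j nj _ mn.
by apply: imin; apply: leq_ltn_trans nj.
Qed.

Lemma chunkE j n : (q (kk j) <= n)%N -> (n < q (kk j.+1))%N -> chunk n = j.+1.
Proof.
rewrite /chunk; case: ex_minnP => i ni imin jn nj.
apply/eqP; rewrite eqn_leq imin//= ltnNge; apply/negP => ij.
by have := qn_homo htheta (kk_homo ij); lia.
Qed.

Lemma Khinchin_step_psi : Khinchin step_psi.
Proof.
have pos n : (0 < n)%N -> 0 < step_psi n.
  by move=> n0; rewrite invr_gt0 mulr_gt0// ltr0n.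
have e n : (0 < n)%N -> n%:R * step_psi n = (t (kk (chunk n)))^-1.
  by move=> n0; rewrite /step_psi invfM mulrA mulfV ?mul1r// pnatr_eq0 -lt0n.
split => //; last first.
  move=> p n p0 pn; rewrite !e//; last exact: leq_trans pn.
  rewrite lef_pV2 ?posrE//; apply: log_den_homo => //; apply: kk_homo.
  exact: chunk_homo.
apply/nneseries_pinftyP => [n n0|c]; first by rewrite ltW// pos.
(* The sum is at least (T' - T) / T', where T and T' >= 2 T are the values of t at the two ends of
   the stretch. *)
have half j : 1 / 2 <= \sum_(q (kk j) <= n < q (kk j.+1)) step_psi n.
  have qq : (q (kk j) <= q (kk j.+1))%N by apply: qn_homo => //; apply: kk_homo.
  have -> : \sum_(q (kk j) <= n < q (kk j.+1)) step_psi n =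
      (t (kk j.+1))^-1 * \sum_(q (kk j) <= n < q (kk j.+1)) n%:R^-1.
    rewrite mulr_sumr; apply: eq_big_nat => n /andP[h1 h2].
    by rewrite /step_psi (chunkE h1 h2) invfM mulrC.
  have := harmonic_ge R (qn_gt0 htheta (kk j)) qq.
  rewrite ln_div ?posrE ?qnR_gt0// -/(t _) -/(t _) => h.
  rewrite ler_pdivlMl//; apply: le_trans h; have := t2 j; lra.
pose J := (Num.truncn (2 * `|c|)).+1.
exists (q (kk J)); first exact: qn_gt0.
apply: (@le_trans _ _ (\sum_(q (kk 0%N) <= n < q (kk J)) step_psi n)); last first.
  rewrite [leRHS](@big_cat_nat _ _ _ (q (kk 0%N)))//=.
  - by rewrite lerDr big_nat sumr_ge0// => n /andP[n0 _]; rewrite ltW// pos.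
  - exact: qn_gt0.
  - by apply: qn_homo => //; apply: kk_homo.
have -> : \sum_(q (kk 0%N) <= n < q (kk J)) step_psi n =
    \sum_(0 <= j < J) \sum_(q (kk j) <= n < q (kk j.+1)) step_psi n.
  elim: J => [|J IH]; first by rewrite !big_geq.
  rewrite big_nat_recr//= -IH -big_cat_nat//=.
    by apply: (qn_homo htheta); apply: kk_homo.
  by apply: (qn_homo htheta); apply: kk_homo.
apply: (@le_trans _ _ (\sum_(0 <= j < J) (1 / 2))); last exact: ler_sum.
rewrite sumr_const_nat subn0 -[leRHS]mulr_natl.
have := truncnS_gt (2 * `|c|); rewrite -/J; have := ler_norm c; lra.
Qed.

(** Borel-Cantelli: the covering of the j-th stretch has measure at most 48 / 2^(j+1). *)
Lemma negligible_W_unit (m : int) :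
  mu.-negligible (W theta step_psi `&` [set s | m%:~R <= s < m%:~R + 1]).
Proof.
have cover j := chunk_cover htheta m (ltnW (kkS j)) (te j.+1) erefl (ltW (tol_gt0 j)) (conc j).
have [G hG] := choice cover.
have mG j : measurable (G j) by have [] := hG j.
exists (lim_sup_set G); split.
- by apply: bigcap_measurable => // N _; apply: bigcup_measurable => n _; exact: mG.
- apply: lim_sup_set_cvg0 => //.
  apply: (@le_lt_trans _ _ (\sum_(j <oo) (48 / (2 ^ j.+1)%:R)%:E)%E).
    apply: lee_nneseries => // j _ ; rewrite natrX.
    by have [_ _ h] := hG j; apply: le_trans h _.
  by apply: le_lt_trans (epsilon_trick0 _ _) _; rewrite ?ltry.
move=> s [/WP Ws ms] J _.
(* As n >= [q (kk J)], its [chunk] index exceeds J; the stretch containing n has the index one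
   below, since [chunkE] returns j + 1. *)
have [n Jn [n0 [p hp]]] := Ws (q (kk J)).
have [j [Jj jn nj]] : exists j, [/\ (J <= j)%N, (q (kk j) <= n)%N & (n < q (kk j.+1))%N].
  have cn : (n < q (kk (chunk n)))%N by rewrite /chunk; case: ex_minnP.
  have Jc : (J < chunk n)%N.
    by rewrite ltnNge; apply/negP => h; have := qn_homo htheta (kk_homo h); lia.
  exists (chunk n).-1; rewrite prednK; last by apply: leq_ltn_trans Jc.
  split=> //; first by lia.
  rewrite leqNgt; apply/negP => h; have : (chunk n <= (chunk n).-1)%N.
    by rewrite {1}/chunk; case: ex_minnP => i _; apply.
  by lia.
exists j => //; have [_ sG _] := hG j; apply: sG.
split => //; exists n; split => //; exists p.
by move: hp; rewrite /step_psi (chunkE jn nj).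
Qed.

Lemma not_full_measure_step_psi : ~ full_measure (W theta step_psi).
Proof.
move=> full.
have nW : mu.-negligible (W theta step_psi).
  (* If W were both null and full, the whole line would be null. Nullity of W is assembled from its
     unit pieces, with the integer part of s as index. *)
  pose U (m : int) := W theta step_psi `&` [set s | m%:~R <= s < m%:~R + 1].
  have nU : mu.-negligible (\bigcup_k (U (Posz k) `|` U (Negz k))).
    apply: negligible_bigcup => k; apply: negligibleU; exact: negligible_W_unit.
  apply: negligibleS nU => s Ws; have fl := Num.Theory.floor_le s.
  have := floorD1_gt s; rewrite intrD => fu.
  by case ez : (Num.floor s) fl fu => [k|k] fl fu; exists k => //; [left|right];
    split => //=; apply/andP.
have : mu.-negligible [set: R].
  by rewrite -(setvU (W theta step_psi)); apply: negligibleU.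
move/(negligibleP _ measurableT) => h.
have h0 : mu [set: R] = 0%E := h.
have : (mu (ball (0 : R)%R 1%R) <= mu [set: R])%E.
  by apply: le_measure; rewrite ?inE//; exact: measurable_ball.
by rewrite h0 lebesgue_measure_ball// lee_fin; lra.
Qed.

End Psi.

Lemma exists_Khinchin_not_full :
  exists2 psi : nat -> R, Khinchin psi & ~ full_measure (W theta psi).
Proof.
have [kk [kk0 kkS t2 conc]] := concentrated_sequence.
exists (step_psi kkS).
  exact: Khinchin_step_psi.
exact: not_full_measure_step_psi.
Qed.

End Counterexample.

(** * Deduction of the equivalence from the two halves *)

(* At the finitely many k with ln (ln (q k)) <= 0 the sequence takes a junk
   real value, which does not affect the upper limit. *)
Theorem theorem1p2 (R : realType) (theta : R) (htheta : irrational theta) :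
  let q (k : nat) : R := (denominator theta k)%:~R in
  (forall psi : nat -> R, Khinchin psi -> full_measure (W theta psi))
  <->
  (exists2 eps : R, 0 < eps &
     (limn_esup (fun k : nat =>
        ((ln (q k))^-1 *
         sum_largest [seq ln (q i.+1 / q i) | i <- iota 0 k]
                     (eps * ln (q k) / ln (ln (q k))))%:E) < 1)%E).
Proof.
have logE k : ln ((denominator theta k)%:~R) = log_den theta k :> R.
  by rewrite /log_den qnRE.
move=> q; split.
- move=> full; apply: contrapT => hB.
  suff [psi Kpsi nf] : exists2 psi : nat -> R, Khinchin psi & ~ full_measure (W theta psi).
    exact: nf (full psi Kpsi).
  (* If concentration failed for one choice of eps, c and K, then c < 1 would bound the expression
     from K on, which is (B). *)
  apply: exists_Khinchin_not_full => // eps c K e0 c1; apply: contrapT => h; apply: hB.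
  exists eps => //; apply/limn_esup_ltP; exists c => //; exists K => k Kk.
  rewrite leNgt; apply/negP => hc; apply: h; exists k => //.
  by move: hc; rewrite /q sum_largest_log_gap// !logE.
- move=> [eps e0 /limn_esup_ltP[c c1 [K hK]]] psi [pos psum pmono].
  have [eta [eta0 eta1 [K' gaps]]] : exists eta, [/\ 0 < eta, eta <= 1 &
      exists K', forall k, (K' <= k)%N ->
      [/\ 64 <= log_den theta k, ln (log_den theta k) <= eta / 2 * log_den theta k
      & eta * log_den theta k <=
        \sum_(0 <= i < k) Num.min (log_gap theta i) (ln (log_den theta k / 8))]].
    apply: (sum_min_gap_ge htheta e0 c1) => k Kk.
    by have := hK k Kk; rewrite /q sum_largest_log_gap// !logE.
  apply: (@W_full _ _ psi (weight htheta psi)) => //.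
  (* Monotonicity of psi follows from m psi(n) <= n psi(n) <= m psi(m). *)
  + move=> m n m0 mn; have n0 : (0 < n)%N by apply: leq_trans mn.
    have mR : 0 < m%:R :> R by rewrite ltr0n.
    rewrite -(ler_pM2l mR); apply: le_trans (pmono _ _ m0 mn).
    by rewrite ler_wpM2r ?ler_nat// ltW// pos.
  + exact: weight_le_psi.
  + exact: weight_ge0.
  + exact: weight_noninc.
  + exact: weight_separated.
  + exact: weight_le1.
  + exact: weight_le_inv.
  + exact: weight_sum_unbounded gaps psum.
Qed.
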